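(* Let $p:X\to S$ be a morphism of noncommutative schemes, with $X$ equipped with a trace functor $\mathrm{Tr}_X:\mathrm{Qcoh}(X)\to\mathrm{Ab}$, and let $C:=p^*\mathcal{O}_S$. (a) For every cyclic system $M$ of coefficients relative to $S$, the system $(C_{X/S}(M)_\bullet,\partial_\bullet,s_\bullet,t_\bullet)$ is a cyclic object in the category of abelian groups. (b) Assume that $\mathrm{Tr}_X$ is faithful relative to $S$. Then for every object $M\in\mathrm{Qcoh}(X)$ with a braiding $\beta:C\otimes_XM\to M\otimes_XC$ with respect to $C=p^*\mathcal{O}_S$ compatible with $\mathrm{Tr}_X$, if the operators $(\partial_\bullet,s_\bullet,t_\bullet)$ defined by $\beta$ satisfy the para-cyclic relations, then $(M,\beta)$ is a cyclic system of coefficients relative to $S$.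
   Context: **Noncommutative schemes.** An object $X$ is an abelian monoidal category $(\mathrm{Qcoh}(X),\otimes_X,\mathcal{O}_X)$; a morphism $p:X\to S$ is an isomorphism class of pairs consisting of an additive (lax) monoidal functor $p_*:\mathrm{Qcoh}(X)\to\mathrm{Qcoh}(S)$ having a left adjoint $p^*$ and a morphism $\mathcal{O}_S\to p_*\mathcal{O}_X$ (unit constraint). Hence $p^*$ is (colax) comonoidal and $C:=p^*\mathcal{O}_S$ is a coalgebra in $\mathrm{Qcoh}(X)$ with comultiplication $\Delta:C\to C\otimes C$ and counit $\varepsilon:C\to\mathcal{O}_X$. Write $\otimes=\otimes_X$. **Trace.** $X$ is equipped with a functor $\mathrm{Tr}_X:\mathrm{Qcoh}(X)\to\mathrm{Ab}$ with natural flip isomorphisms $\mathrm{Tr}_X(\mathcal{F}_1\otimes\mathcal{F}_2)\cong\mathrm{Tr}_X(\mathcal{F}_2\otimes\mathcal{F}_1)$ (model case: $X=\mathrm{Spec}(A)=(\mathrm{Bimod}(A),\otimes_A,A)$, $\mathrm{Tr}_X=(-)\otimes_{A^o\otimes A}A$). **System of coefficients.** An object $M\in\mathrm{Qcoh}(X)$ with a braiding, i.e. an isomorphism $\beta:C\otimes M\to M\otimes C$, such that (identity morphisms denoted by the objects): - I: $(M\otimes\Delta\otimes C)(\beta\otimes C)(C\otimes\beta)=(\beta\otimes C\otimes C)(C\otimes\beta\otimes C)(C\otimes C\otimes\beta)(C\otimes\Delta\otimes M)$, maps $C\otimes C\otimes M\to M\otimes C\otimes C\otimes C$; - II: $(C\otimes\beta\otimes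 C)(\Delta\otimes M\otimes C)(\beta^{-1}\otimes C)(M\otimes\Delta)=(C\otimes M\otimes\Delta)(C\otimes\beta)(\Delta\otimes M)\beta^{-1}$, maps $M\otimes C\to C\otimes M\otimes C\otimes C$; - III: $(C\otimes\beta^{-1})(C\otimes M\otimes\varepsilon\otimes C)(C\otimes\beta\otimes C)(\Delta\otimes M\otimes C)=(\Delta\otimes M)\beta^{-1}(M\otimes\varepsilon\otimes C)(\beta\otimes C)$, maps $C\otimes M\otimes C\to C\otimes C\otimes M$; - IV: $\beta=(M\otimes\varepsilon\otimes C)(\beta\otimes C)(C\otimes\beta)(\Delta\otimes M)$; - V: $(M\otimes\varepsilon)\beta(C\otimes\varepsilon\otimes M)=(M\otimes\varepsilon)\beta(C\otimes M\otimes\varepsilon)(C\otimes\beta)$, maps $C\otimes C\otimes M\to M$; - VI: $\beta(C\otimes\varepsilon\otimes M)=(M\otimes\varepsilon\otimes C)(\beta\otimes C)(C\otimes\beta)$, maps $C\otimes C\otimes M\to M\otimes C$. **Braiding-trace compatibility.** The braiding is compatible with $\mathrm{Tr}_X$ if for all $p,q>0$ the following squares commute, vertical arrows being induced by transpositions of copies of $C$ with $M$ via $\beta$ or $\beta^{-1}$, horizontal ones by flips: (1) top $\mathrm{Tr}_X(C^{\otimes p}\otimes M\otimes C^{\otimes q})\to\mathrm{Tr}_X(C^{\otimes p+1}\otimes M\otimes C^{\otimes q-1})$, bottom $\mathrm{Tr}_X(C^{\otimes p-1}\otimes M\otimes C^{\otimes q+1})\to\mathrm{Tr}_X(C^{\otimes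 p}\otimes M\otimes C^{\otimes q})$; (2) top $\mathrm{Tr}_X(C^{\otimes p}\otimes M)\to\mathrm{Tr}_X(M\otimes C^{\otimes p})$, bottom $\mathrm{Tr}_X(C^{\otimes p-1}\otimes M\otimes C)\to\mathrm{Tr}_X(C^{\otimes p}\otimes M)$. A cyclic system of coefficients relative to $S$ is a system of coefficients whose braiding is compatible with $\mathrm{Tr}_X$. **The operators.** $C_{X/S}(M)_n:=\mathrm{Tr}_X(M\otimes C^{\otimes n})$, and in element-wise notation (flips used implicitly to move tensor factors cyclically): $\partial_0\mathrm{Tr}_X(m,c_1,\dots,c_n)=\mathrm{Tr}_X(m\varepsilon(c_1),c_2,\dots,c_n)$; $\partial_i\mathrm{Tr}_X(m,c_1,\dots,c_n)=\mathrm{Tr}_X(m,c_1,\dots,c_i\varepsilon(c_{i+1}),\dots,c_n)$, $i=1,\dots,n-1$; $\partial_n\mathrm{Tr}_X(m,c_1,\dots,c_n)=\mathrm{Tr}_X((1\otimes\varepsilon)\beta(c_n,m),c_1,\dots,c_{n-1})$; $s_i\mathrm{Tr}_X(m,c_1,\dots,c_n)=\mathrm{Tr}_X(m,c_1,\dots,\Delta(c_{i+1}),\dots,c_n)$, $i=0,\dots,n-1$; $s_n\mathrm{Tr}_X(m,c_1,\dots,c_n)=\sum\mathrm{Tr}_X(\beta(c'_{1(2)},m'),c_2,\dots,c_n,c'_{1(1)})$, where $\beta^{-1}(m,c_1)=\sum c'_1\otimes m'$ and $\Delta(c)=\sum c_{(1)}\otimes c_{(2)}$; $t_n\mathrm{Tr}_X(m,c_1,\dots,c_n)=\mathrm{Tr}_X(\beta(c_n,m),c_1,\dots,c_{n-1})$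 (with $t_0=\mathrm{id}$). Relations are understood wherever these operators are defined. **Cyclic object.** A collection $\partial_i:C_n\to C_{n-1}$, $s_i:C_n\to C_{n+1}$ ($0\le i\le n$), $t_n:C_n\to C_n$ in an abelian category with: $\partial_i\partial_j=\partial_{j-1}\partial_i$ ($i<j$); $s_is_j=s_{j+1}s_i$ ($i\le j$); $\partial_is_j=s_{j-1}\partial_i$ ($i<j$), $=\mathrm{id}$ ($i=j,j+1$), $=s_j\partial_{i-1}$ ($i>j+1$); $\partial_it_n=t_{n-1}\partial_{i-1}$ ($1\le i\le n$); $\partial_0t_n=\partial_n$; $s_it_n=t_{n+1}s_{i-1}$ ($1\le i\le n$); $s_0t_n=t_{n+1}^2s_n$; $t_n^{n+1}=1$. The para-cyclic relations are all of these except $t_n^{n+1}=1$. **Faithfulness.** $\mathrm{Tr}_X$ is faithful relative to $S$ if for every $n>0$ the functor $C_{X/S}(-)_n=\mathrm{Tr}_X((-)\otimes C^{\otimes n}):\mathrm{Qcoh}(X)\to\mathrm{Ab}$ is faithful.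
   Formalization: The natural flips of the trace functor are also assumed coherent: flipping twice is the identity, and flipping a product past an object equals flipping its factors in turn. Without this (a) fails, e.g. for flips multiplied by -1 on vector spaces, where t_2^3 = -1. *)

(* Defs.v *)
From HB Require Import structures.
From mathcomp Require Import all_boot ssralg boolp.

Set Implicit Arguments.
Unset Strict Implicit.
Unset Printing Implicit Defensive.

Import GRing.Theory.

Declare Scope cat_scope.
Delimit Scope cat_scope with cat.
Reserved Notation "a \ox b" (at level 45, right associativity).
Reserved Notation "f \oxm g" (at level 45, right associativity).
Reserved Notation "a \oxl f" (at level 45, right associativity).

Record category := Category {
  ob :> Type;
  hom : ob -> ob -> Type;
  idm : forall a, hom a a;
  compm : forall a b c, hom b c -> hom a b -> hom a c;
  comp1m : forall a b (f : hom a b), compm (idm b) f = f;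
  compm1 : forall a b (f : hom a b), compm f (idm a) = f;
  compmA : forall a b c d (h : hom c d) (g : hom b c) (f : hom a b),
    compm h (compm g f) = compm (compm h g) f }.

Arguments hom {_} a b.
Arguments idm {_} a.
Arguments compm {_ a b c} g f.

Notation "g \o f" := (compm g f)
  (at level 50, format "g  \o '/ '  f") : cat_scope.
Local Open Scope cat_scope.

Record iso (A : category) (a b : A) := Iso {
  iso_fwd : hom a b;
  iso_bwd : hom b a;
  iso_fwdK : iso_bwd \o iso_fwd = idm a;
  iso_bwdK : iso_fwd \o iso_bwd = idm b }.

Record functor (A B : category) := Functor {
  fob :> A -> B;
  fmor : forall a b, hom a b -> hom (fob a) (fob b);
  fmor1 : forall a, fmor (idm a) = idm (fob a);
  fmorM : forall a b c (g : hom b c) (f : hom a b),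
    fmor (g \o f) = fmor g \o fmor f }.

Arguments fmor {A B} F {a b} f : rename.

Definition faithful (A B : category) (F : functor A B) : Prop :=
  forall (a b : A) (f g : hom a b), fmor F f = fmor F g -> f = g.

Definition functor_comp (A B D : category)
  (G : functor B D) (F : functor A B) : functor A D.
Proof.
by refine (@Functor A D (fun a => G (F a)) (fun _ _ f => fmor G (fmor F f)) _ _);
  move=> *; rewrite ?fmor1 ?fmorM.
Defined.

Record adjunction (A B : category) (L : functor B A) (R : functor A B) :=
  Adjunction {
  adj_unit : forall b, hom b (R (L b));
  adj_counit : forall a, hom (L (R a)) a;
  adj_unit_nat : forall b b' (f : hom b b'),
    adj_unit b' \o f = fmor R (fmor L f) \o adj_unit b;
  adj_counit_nat : forall a a' (f : hom a a'),
    f \o adj_counit a = adj_counit a' \o fmor L (fmor R f);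
  adj_triangleL : forall b, adj_counit (L b) \o fmor L (adj_unit b) = idm (L b);
  adj_triangleR : forall a, fmor R (adj_counit a) \o adj_unit (R a) = idm (R a) }.

Definition zhom (A : category) (zcl : forall a b : A, GRing.Zmodule (hom a b))
  (a b : A) : zmodType := GRing.Zmodule.Pack (zcl a b).

Record preadditive := Preadditive {
  pcat :> category;
  hom_class : forall a b : pcat, GRing.Zmodule (hom a b);
  compmDl : forall a b c (g g' : zhom hom_class b c) (f : zhom hom_class a b),
    compm (g + g')%R f = ((compm g f : zhom hom_class a c) + compm g' f)%R;
  compmDr : forall a b c (g : zhom hom_class b c) (f f' : zhom hom_class a b),
    compm g (f + f')%R = ((compm g f : zhom hom_class a c) + compm g f')%R }.

HB.instance Definition _ (A : preadditive) (a b : A) :=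
  GRing.Zmodule.copy (@hom A a b) (zhom (@hom_class A) a b).

Section AbelianNotions.
Variable A : preadditive.

Definition is_zero_object (z : A) : Prop :=
  forall a : A, (exists! f : hom z a, True) /\ (exists! f : hom a z, True).

Definition is_biproduct (a b c : A) : Prop :=
  exists (i1 : hom a c) (i2 : hom b c) (p1 : hom c a) (p2 : hom c b),
    [/\ p1 \o i1 = idm a, p2 \o i2 = idm b,
        p1 \o i2 = 0%R, p2 \o i1 = 0%R &
        ((i1 \o p1) + (i2 \o p2))%R = idm c].

Definition is_kernel (a b k : A) (f : hom a b) (i : hom k a) : Prop :=
  f \o i = 0%R /\
  forall (c : A) (g : hom c a), f \o g = 0%R -> exists! h : hom c k, i \o h = g.

Definition is_cokernel (a b q : A) (f : hom a b) (p : hom b q) : Prop :=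
  p \o f = 0%R /\
  forall (c : A) (g : hom b c), g \o f = 0%R -> exists! h : hom q c, h \o p = g.

Definition is_mono (a b : A) (f : hom a b) : Prop :=
  forall (c : A) (g h : hom c a), f \o g = f \o h -> g = h.

Definition is_epi (a b : A) (f : hom a b) : Prop :=
  forall (c : A) (g h : hom b c), g \o f = h \o f -> g = h.

End AbelianNotions.

Record abelian := Abelian {
  abcat :> preadditive;
  ab_zero : exists z : abcat, is_zero_object z;
  ab_biproduct : forall a b : abcat, exists c : abcat, is_biproduct a b c;
  ab_kernel : forall (a b : abcat) (f : hom a b),
    exists (k : abcat) (i : hom k a), is_kernel f i;
  ab_cokernel : forall (a b : abcat) (f : hom a b),
    exists (q : abcat) (p : hom b q), is_cokernel f p;
  ab_mono_normal : forall (a b : abcat) (f : hom a b), is_mono f ->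
    exists (c : abcat) (g : hom b c), is_kernel g f;
  ab_epi_normal : forall (a b : abcat) (f : hom a b), is_epi f ->
    exists (c : abcat) (g : hom c a), is_cokernel g f }.

Definition additive_functor (A B : preadditive) (F : functor A B) : Prop :=
  forall (a b : A) (f g : hom a b), fmor F (f + g)%R = (fmor F f + fmor F g)%R.

Lemma additive_eq (U V : zmodType) (f g : {additive U -> V}) : f =1 g -> f = g.
Proof.
move: f g => [f [[f0]]] [g [[g0]]] /= fg.
have {}fg : f = g by apply/funext.
by subst g; rewrite (Prop_irrelevance f0 g0).
Qed.

Definition Ab : category.
Proof.
by refine (@Category zmodType (fun U V => {additive U -> V})
    (fun U => (idfun : {additive U -> U}))
    (fun U V W (g : {additive V -> W}) (f : {additive U -> V}) =>
       ((g \o f)%FUN : {additive U -> W})) _ _ _);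
  move=> *; apply: additive_eq.
Defined.

Record monoidal (A : category) := Monoidal {
  tob : A -> A -> A;
  tmor : forall a a' b b', hom a a' -> hom b b' -> hom (tob a b) (tob a' b');
  unit_ob : A;
  assoc : forall a b c, iso (tob (tob a b) c) (tob a (tob b c));
  lunit : forall a, iso (tob unit_ob a) a;
  runit : forall a, iso (tob a unit_ob) a;
  tmor1 : forall a b, tmor (idm a) (idm b) = idm (tob a b);
  tmorM : forall a a' a'' b b' b''
    (g : hom a' a'') (f : hom a a') (k : hom b' b'') (h : hom b b'),
    tmor (g \o f) (k \o h) = tmor g k \o tmor f h;
  assoc_nat : forall a a' b b' c c' (f : hom a a') (g : hom b b') (h : hom c c'),
    iso_fwd (assoc a' b' c') \o tmor (tmor f g) h =
    tmor f (tmor g h) \o iso_fwd (assoc a b c);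
  lunit_nat : forall a a' (f : hom a a'),
    iso_fwd (lunit a') \o tmor (idm unit_ob) f = f \o iso_fwd (lunit a);
  runit_nat : forall a a' (f : hom a a'),
    iso_fwd (runit a') \o tmor f (idm unit_ob) = f \o iso_fwd (runit a);
  pentagon : forall a b c d,
    iso_fwd (assoc a b (tob c d)) \o iso_fwd (assoc (tob a b) c d) =
    tmor (idm a) (iso_fwd (assoc b c d)) \o
      (iso_fwd (assoc a (tob b c) d) \o tmor (iso_fwd (assoc a b c)) (idm d));
  triangle : forall a b,
    tmor (idm a) (iso_fwd (lunit b)) \o iso_fwd (assoc a unit_ob b) =
    tmor (iso_fwd (runit a)) (idm b) }.

Record ncscheme := NCScheme {
  qcoh :> abelian;
  qcoh_monoidal : monoidal qcoh }.

Section SchemeNotations.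
Variable X : ncscheme.

Definition ten (a b : X) : X := tob (qcoh_monoidal X) a b.
Definition tenm (a a' b b' : X) (f : hom a a') (g : hom b b') :
  hom (ten a b) (ten a' b') := tmor (qcoh_monoidal X) f g.
Definition OO : X := unit_ob (qcoh_monoidal X).
Definition asc (a b c : X) : hom (ten (ten a b) c) (ten a (ten b c)) :=
  iso_fwd (assoc (qcoh_monoidal X) a b c).
Definition asc' (a b c : X) : hom (ten a (ten b c)) (ten (ten a b) c) :=
  iso_bwd (assoc (qcoh_monoidal X) a b c).
Definition lun (a : X) : hom (ten OO a) a := iso_fwd (lunit (qcoh_monoidal X) a).
Definition lun' (a : X) : hom a (ten OO a) := iso_bwd (lunit (qcoh_monoidal X) a).
Definition run (a : X) : hom (ten a OO) a := iso_fwd (runit (qcoh_monoidal X) a).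
Definition run' (a : X) : hom a (ten a OO) := iso_bwd (runit (qcoh_monoidal X) a).

End SchemeNotations.

Arguments ten {X} a b.
Arguments tenm {X a a' b b'} f g.
Arguments OO X : clear implicits.

Notation "a \ox b" := (ten a b) : cat_scope.
Notation "f \oxm g" := (tenm f g) : cat_scope.
(** [a \oxl f] is the morphism written [a (x) f] when the identity of [a] is
    denoted by [a] itself. *)
Notation "a \oxl f" := (tenm (idm a) f) : cat_scope.

Record lax_monoidal (X S : ncscheme) (F : functor X S) := LaxMonoidal {
  lax_unit : hom (OO S) (F (OO X));
  lax_mul : forall a b : X, hom (F a \ox F b) (F (a \ox b));
  lax_mul_nat : forall (a a' b b' : X) (f : hom a a') (g : hom b b'),
    lax_mul a' b' \o (fmor F f \oxm fmor F g) = fmor F (f \oxm g) \o lax_mul a b;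
  lax_assoc : forall a b c : X,
    fmor F (asc a b c) \o (lax_mul (a \ox b) c \o (lax_mul a b \oxm idm (F c))) =
    lax_mul a (b \ox c) \o ((F a \oxl lax_mul b c) \o asc (F a) (F b) (F c));
  lax_lunit : forall a : X,
    fmor F (lun a) \o (lax_mul (OO X) a \o (lax_unit \oxm idm (F a))) = lun (F a);
  lax_runit : forall a : X,
    fmor F (run a) \o (lax_mul a (OO X) \o (F a \oxl lax_unit)) = run (F a) }.

(** A representative of the isomorphism class which is a morphism [X -> S]. *)
Record ncmorphism (X S : ncscheme) := NCMorphism {
  push : functor X S;
  push_additive : additive_functor push;
  push_lax : lax_monoidal push;
  pull : functor S X;
  pull_push : adjunction pull push }.

Section Coalgebra.
Variables (X S : ncscheme) (p : ncmorphism X S).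

(** The colax structure on the left adjoint of a lax monoidal functor: the
    transposes of the lax structure maps under the adjunction. *)
Definition colax_mul (a b : S) : hom (pull p (a \ox b)) (pull p a \ox pull p b) :=
  adj_counit (pull_push p) (pull p a \ox pull p b) \o
  fmor (pull p) (lax_mul (push_lax p) (pull p a) (pull p b) \o
                 (adj_unit (pull_push p) a \oxm adj_unit (pull_push p) b)).

Definition colax_unit : hom (pull p (OO S)) (OO X) :=
  adj_counit (pull_push p) (OO X) \o fmor (pull p) (lax_unit (push_lax p)).

Definition coalg : X := pull p (OO S).

Definition comul : hom coalg (coalg \ox coalg) :=
  colax_mul (OO S) (OO S) \o fmor (pull p) (lun' (OO S)).

Definition counit : hom coalg (OO X) := colax_unit.

End Coalgebra.

(** The flips move tensor factors cyclically in a consistent way: flipping twice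
    is the identity, and flipping [b (x) c] past [a] amounts to flipping [c] and
    then [b].  Without this the iterated flips of a tensor word would not be
    determined by the resulting cyclic permutation of its factors. *)
Record trace_functor (X : ncscheme) := TraceFunctor {
  tr :> functor X Ab;
  flip : forall a b : X, hom (tr (a \ox b)) (tr (b \ox a));
  flip_nat : forall (a a' b b' : X) (f : hom a a') (g : hom b b'),
    flip a' b' \o fmor tr (f \oxm g) = fmor tr (g \oxm f) \o flip a b;
  flipK : forall a b : X, flip b a \o flip a b = idm (tr (a \ox b));
  flip_cycle : forall a b c : X,
    flip a (b \ox c) =
    fmor tr (asc' b c a) \o (flip (c \ox a) b \o
      (fmor tr (asc' c a b) \o (flip (a \ox b) c \o fmor tr (asc' a b c)))) }.

(** [D] is the set of degrees in which the degeneracies are defined: all of them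
    for a cyclic object in the usual sense.  The indices [i] of [face _ n i] and
    [degen _ i] are only meaningful for [i <= n.+1], resp. [i <= n]; the values
    at other indices occur in no relation. *)
Record cyclic_ops (A : category) (D : pred nat) := CyclicOps {
  cyc_ob : nat -> A;
  face : forall n : nat, nat -> hom (cyc_ob n.+1) (cyc_ob n);
  degen : forall n : nat, D n -> nat -> hom (cyc_ob n) (cyc_ob n.+1);
  cyc : forall n : nat, hom (cyc_ob n) (cyc_ob n) }.

Arguments degen {A D} c {n} Dn i : rename.

(** Each relation is imposed in exactly those degrees in which all the operators
    occurring in it are defined. *)
Record paracyclic (A : category) (D : pred nat) (E : cyclic_ops A D) : Prop := {
  face_face : forall n i j, i < j <= n.+2 ->
    face E n i \o face E n.+1 j = face E n j.-1 \o face E n.+1 i;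
  degen_degen : forall n (Dn : D n) (Dn1 : D n.+1) i j, i <= j <= n ->
    degen E Dn1 i \o degen E Dn j = degen E Dn1 j.+1 \o degen E Dn i;
  face_degen_lt : forall n (Dn : D n) (Dn1 : D n.+1) i j, i < j <= n.+1 ->
    face E n.+1 i \o degen E Dn1 j = degen E Dn j.-1 \o face E n i;
  face_degen_id : forall n (Dn : D n) i, i <= n ->
    face E n i \o degen E Dn i = idm (cyc_ob E n);
  face_degen_idS : forall n (Dn : D n) i, i <= n ->
    face E n i.+1 \o degen E Dn i = idm (cyc_ob E n);
  face_degen_gt : forall n (Dn : D n) (Dn1 : D n.+1) i j, j.+1 < i <= n.+2 ->
    face E n.+1 i \o degen E Dn1 j = degen E Dn j \o face E n i.-1;
  face_cyc : forall n i, 0 < i <= n.+1 ->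
    face E n i \o cyc E n.+1 = cyc E n \o face E n i.-1;
  face0_cyc : forall n, face E n 0 \o cyc E n.+1 = face E n n.+1;
  degen_cyc : forall n (Dn : D n) i, 0 < i <= n ->
    degen E Dn i \o cyc E n = cyc E n.+1 \o degen E Dn i.-1;
  degen0_cyc : forall n (Dn : D n),
    degen E Dn 0 \o cyc E n = cyc E n.+1 \o (cyc E n.+1 \o degen E Dn n) }.

Record cyclic (A : category) (D : pred nat) (E : cyclic_ops A D) : Prop := {
  cyclic_para :> paracyclic E;
  cyc_period : forall n,
    iter n.+1 (fun f => cyc E n \o f) (idm (cyc_ob E n)) = idm (cyc_ob E n) }.

Section Coefficients.
Variables (X S : ncscheme) (p : ncmorphism X S).

Local Notation C := (coalg p).

Definition braiding (M : X) := iso (C \ox M) (M \ox C).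

(** The structure maps acting on the leftmost factors of a right-bracketed
    tensor product whose remaining part is [U]. *)
Definition comulT (U : X) : hom (C \ox U) (C \ox C \ox U) :=
  asc C C U \o (comul p \oxm idm U).
Definition counitT (U : X) : hom (C \ox U) U :=
  lun U \o (counit p \oxm idm U).

Section Braiding.
Variables (M : X) (b : braiding M).

Local Notation beta := (iso_fwd b).
Local Notation beta' := (iso_bwd b).

Definition braidT (U : X) : hom (C \ox M \ox U) (M \ox C \ox U) :=
  asc M C U \o ((beta \oxm idm U) \o asc' C M U).
Definition braidT' (U : X) : hom (M \ox C \ox U) (C \ox M \ox U) :=
  asc C M U \o ((beta' \oxm idm U) \o asc' M C U).

Definition counitR : hom (M \ox C) M := run M \o (M \oxl counit p).

Record coefficients : Prop := {
  coeff_I :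
    (M \oxl comulT C) \o braidT C \o (C \oxl beta) =
    braidT (C \ox C) \o (C \oxl braidT C) \o (C \oxl C \oxl beta) \o
      (C \oxl comulT M);
  coeff_II :
    (C \oxl braidT C) \o comulT (M \ox C) \o braidT' C \o (M \oxl comul p) =
    (C \oxl M \oxl comul p) \o (C \oxl beta) \o comulT M \o beta';
  coeff_III :
    (C \oxl beta') \o (C \oxl M \oxl counitT C) \o (C \oxl braidT C) \o
      comulT (M \ox C) =
    comulT M \o beta' \o (M \oxl counitT C) \o braidT C;
  coeff_IV :
    beta = (M \oxl counitT C) \o braidT C \o (C \oxl beta) \o comulT M;
  coeff_V :
    counitR \o beta \o (C \oxl counitT M) =
    counitR \o beta \o (C \oxl counitR) \o (C \oxl beta);
  coeff_VI :
    beta \o (C \oxl counitT M) = (M \oxl counitT C) \o braidT C \o (C \oxl beta) }.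

End Braiding.

(** [Cten n F] is [C^n (x) F], and [Cpow n] is [C^n]. *)
Definition Cten (n : nat) (F : X) : X := iter n (fun G => C \ox G) F.
Definition Cpow (n : nat) : X := Cten n (OO X).

Fixpoint Cten_mor (n : nat) (F G : X) (f : hom F G) : hom (Cten n F) (Cten n G) :=
  match n with 0 => f | n'.+1 => C \oxl Cten_mor n' f end.

(** [C^n (x) F], bracketed as a product of two objects. *)
Fixpoint Cten_split (n : nat) (F : X) : hom (Cten n F) (Cpow n \ox F) :=
  match n with
  | 0 => lun' F
  | n'.+1 => asc' C (Cpow n') F \o (C \oxl Cten_split n' F)
  end.

(** Appending a copy of [C] on the right, and its inverse. *)
Fixpoint Cpow_snoc (n : nat) : hom (Cpow n \ox C) (Cpow n.+1) :=
  match n with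
  | 0 => run' C \o lun C
  | n'.+1 => (C \oxl Cpow_snoc n') \o asc C (Cpow n') C
  end.
Fixpoint Cpow_unsnoc (n : nat) : hom (Cpow n.+1) (Cpow n \ox C) :=
  match n with
  | 0 => lun' C \o run C
  | n'.+1 => asc' C (Cpow n') C \o (C \oxl Cpow_unsnoc n')
  end.

Variable Tr : trace_functor X.

Section Words.
Variable M : X.

(** [C^m (x) M (x) C^n] *)
Definition CMC (m n : nat) : X := Cten m (M \ox Cpow n).

Fixpoint CMC_snoc (m n : nat) : hom (CMC m n \ox C) (CMC m n.+1) :=
  match m with
  | 0 => (M \oxl Cpow_snoc n) \o asc M (Cpow n) C
  | m'.+1 => (C \oxl CMC_snoc m' n) \o asc C (CMC m' n) C
  end.
Fixpoint CMC_unsnoc (m n : nat) : hom (CMC m n.+1) (CMC m n \ox C) :=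
  match m with
  | 0 => asc' M (Cpow n) C \o (M \oxl Cpow_unsnoc n)
  | m'.+1 => asc' C (CMC m' n) C \o (C \oxl CMC_unsnoc m' n)
  end.

(** The flip moving the last copy of [C] to the front, and its inverse. *)
Definition last_to_front (m n : nat) : hom (Tr (CMC m n.+1)) (Tr (CMC m.+1 n)) :=
  flip Tr (CMC m n) C \o fmor Tr (CMC_unsnoc m n).
Definition front_to_last (m n : nat) : hom (Tr (CMC m.+1 n)) (Tr (CMC m n.+1)) :=
  fmor Tr (CMC_snoc m n) \o flip Tr C (CMC m n).

(** The flip [Tr (C^n (x) M) -> Tr (M (x) C^n)]. *)
Definition powers_to_back (n : nat) : hom (Tr (CMC n 0)) (Tr (CMC 0 n)) :=
  fmor Tr (run M \oxm idm (Cpow n)) \o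
  (flip Tr (Cpow n) (M \ox OO X) \o fmor Tr (Cten_split n (M \ox OO X))).

Variable b : braiding M.

(** [C^(m+1) (x) M (x) C^n -> C^m (x) M (x) C^(n+1)], by [beta] on the copy of
    [C] immediately to the left of [M]. *)
Fixpoint braid_right (m n : nat) : hom (CMC m.+1 n) (CMC m n.+1) :=
  match m with
  | 0 => braidT b (Cpow n)
  | m'.+1 => C \oxl braid_right m' n
  end.

(** [M (x) C^n -> C^n (x) M], by [n] successive applications of [beta^-1]. *)
Fixpoint unbraid_all (n : nat) : hom (CMC 0 n) (CMC n 0) :=
  match n with
  | 0 => idm (CMC 0 0)
  | n'.+1 => (C \oxl unbraid_all n') \o braidT' b (Cpow n')
  end.

(** The squares for [C^(m+1) (x) M (x) C^(n+1)] and for [C^(m+1) (x) M]; the flips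
    are the top and bottom sides, the maps induced by the braiding the vertical
    ones. *)
Record trace_compatible : Prop := {
  compat_square1 : forall m n,
    fmor Tr (braid_right m.+1 n) \o last_to_front m.+1 n =
    last_to_front m n.+1 \o fmor Tr (braid_right m n.+1);
  compat_square2 : forall m,
    fmor Tr (unbraid_all m.+1) \o powers_to_back m.+1 =
    last_to_front m 0 \o fmor Tr (braid_right m 0) }.

Definition cyclic_system : Prop := coefficients b /\ trace_compatible.

End Words.

(** Applying [counit], resp. [comul], to the copy of [C] in position [i],
    counting from 0 for [i <= n] (the values for [i > n] are junk). *)
Fixpoint counit_at (n i : nat) : hom (Cpow n.+1) (Cpow n) :=
  match n with
  | 0 => counitT (Cpow 0)
  | n'.+1 =>
      if i is i'.+1 then C \oxl counit_at n' i' else counitT (Cpow n'.+1)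
  end.
Fixpoint comul_at (n i : nat) : hom (Cpow n.+1) (Cpow n.+2) :=
  match n with
  | 0 => comulT (Cpow 0)
  | n'.+1 =>
      if i is i'.+1 then C \oxl comul_at n' i' else comulT (Cpow n'.+1)
  end.

Definition tensor_right (G : X) : functor X X.
Proof.
refine (@Functor X X (fun F => F \ox G) (fun _ _ f => f \oxm idm G) _ _).
- by move=> a; apply: tmor1.
- by move=> a c d g f; rewrite -[in LHS](comp1m (idm G)); apply: tmorM.
Defined.

(** The functor [C_(X/S)(-)_n = Tr ((-) (x) C^n)]. *)
Definition cyclic_chain (n : nat) : functor X Ab :=
  functor_comp Tr (tensor_right (Cpow n)).

Definition trace_faithful : Prop := forall n, 0 < n -> faithful (cyclic_chain n).

Section Operators.
Variables (M : X) (b : braiding M).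

Definition tr_face (n i : nat) : hom (cyclic_chain n.+1 M) (cyclic_chain n M) :=
  if i <= n then fmor Tr (M \oxl counit_at n i)
  else fmor Tr ((M \oxl counitT (Cpow n)) \o braidT b (Cpow n)) \o
       last_to_front M 0 n.

(** [s_i] on [Tr (M (x) C^n)] involves the factor [c_1] already for [i = 0 = n],
    so that it is defined only for [n > 0]. *)
Definition tr_degen (n : nat) :
  0 < n -> nat -> hom (cyclic_chain n M) (cyclic_chain n.+1 M) :=
  match n with
  | 0 => fun n_gt0 _ => False_rect _ (notF n_gt0)
  | k.+1 => fun _ i =>
      if i <= k then fmor Tr (M \oxl comul_at k i)
      else front_to_last M 0 k.+1 \o
           fmor Tr ((C \oxl braidT b (Cpow k)) \o
                    comulT (M \ox Cpow k) \o braidT' b (Cpow k))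
  end.

Definition tr_cyc (n : nat) : hom (cyclic_chain n M) (cyclic_chain n M) :=
  match n with
  | 0 => idm (cyclic_chain 0 M)
  | k.+1 => fmor Tr (braidT b (Cpow k)) \o last_to_front M 0 k
  end.

Definition tr_ops : cyclic_ops Ab (fun n => 0 < n) :=
  CyclicOps tr_face tr_degen tr_cyc.

End Operators.

End Coefficients.

(* Main.v *)
From HB Require Import structures.
From mathcomp Require Import all_boot.
Require Import Defs.

(** Both directions rest on a dictionary between the relations of a cyclic object
    and the axioms I-VI.

    Every operator is the trace of a map acting on the leftmost factors of a
    right-bracketed word, possibly composed with the flip that moves the last
    copy of [C] to the front or back.  By naturality such a flip commutes with
    any map that leaves the moved factor alone ([last_to_front_natural]).  If the
    counit or the comultiplication is applied to the moved factor, the flip still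
    commutes with it, because flipping the unit object is trivial ([flip_unit])
    and flipping [C (x) C] is two successive flips ([last_to_front_counit],
    [last_to_front_comul]).  Hence most relations reduce to naturality or to a
    coalgebra law.  In each of the following ones the flips cancel, and what
    remains is the trace of one axiom:
      - [d_(n+1) t_(n+1) = t_n d_n] is VI for n > 0;
      - [d_(n+1) s_n = 1] is IV;
      - [d_0 s_(n+1) = s_n d_0] is III;
      - [s_0 s_n = s_(n+1) s_0] is II;
      - [s_0 t_n = t_(n+1)^2 s_n] is I for n > 1.
    The two relations left over in the lowest degrees follow from [t^(n+1) = 1],
    and the other ones that involve the last face follow from [d_0 t_n = d_n].  This
    proves (a).  For (b) the dictionary is read backwards, with a tail [C] to the
    right of the maps on which the relation turns: both sides of the relation
    become traces of the two sides of the axiom tensored with [C], and the trace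
    is faithful on those.  Axiom V follows from VI by composing with the counit
    ([axiom_V_of_VI]).

    For [t^(n+1) = 1], moving the copies of [C] to the front one by one, and
    braiding each back past [M], can be done in two separate phases, so that
    [t^n] first flips all of [C^n] to the front and then braids all of it back
    ([iterated_rotation]).  The second compatibility square says that one more
    rotation undoes this.

    The coherence isomorphisms are kept under control by one notion: a map [g]
    between right-bracketed words lifts a map [f] when it is [f (x) U] up to
    reassociation ([lifts]).  Taking [U] to be the tail of a word relates the
    axioms to maps inside longer words; taking [U = C] to be an appended last
    factor is what makes the flips natural. *)

Set Implicit Arguments.
Unset Strict Implicit.
Unset Printing Implicit Defensive.

Local Open Scope cat_scope.

(** * Composition in a category *)

(** Composition is locked so that rewriting modulo associativity treats the
    named structure maps as atoms, although many of them are defined as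
    composites. *)
HB.lock Definition cmp (A : category) (a b c : A) (g : hom b c) (f : hom a b) :
  hom a c := compm g f.
Notation "g ∘ f" := (cmp g f) (at level 50, format "g  ∘ '/ '  f") : cat_scope.

Section Composition.
Variable A : category.

Lemma cmpE (a b c : A) (g : hom b c) (f : hom a b) : g \o f = g ∘ f.
Proof. by rewrite unlock. Qed.

Lemma cmp1m (a b : A) (f : hom a b) : idm b ∘ f = f.
Proof. by rewrite -cmpE comp1m. Qed.

Lemma cmpm1 (a b : A) (f : hom a b) : f ∘ idm a = f.
Proof. by rewrite -cmpE compm1. Qed.

Lemma cmpA (a b c d : A) (h : hom c d) (g : hom b c) (f : hom a b) :
  h ∘ (g ∘ f) = (h ∘ g) ∘ f.
Proof. by rewrite -!cmpE compmA. Qed.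

Lemma iso_fwd_cmp (a b : A) (i : iso a b) : iso_bwd i ∘ iso_fwd i = idm a.
Proof. by rewrite -cmpE iso_fwdK. Qed.

Lemma iso_bwd_cmp (a b : A) (i : iso a b) : iso_fwd i ∘ iso_bwd i = idm b.
Proof. by rewrite -cmpE iso_bwdK. Qed.

End Composition.

Lemma fmor_cmp (A B : category) (F : functor A B) (a b c : A)
    (g : hom b c) (f : hom a b) :
  fmor F (g ∘ f) = fmor F g ∘ fmor F f.
Proof. by rewrite -!cmpE fmorM. Qed.

Section CategoryLemmas.
Variable A : category.

(** Composites are kept bracketed to the right; this form rewrites an equation
    between composites at the head of a longer one. *)
Lemma comp_eql (a b c : A) (g : hom b c) (f : hom a b) (k : hom a c) :
  g ∘ f = k -> forall z (h : hom z a), g ∘ (f ∘ h) = k ∘ h.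
Proof. by move=> <- z h; rewrite cmpA. Qed.

Lemma comp_idl (a b : A) (g : hom b a) (f : hom a b) :
  g ∘ f = idm a -> forall z (h : hom z a), g ∘ (f ∘ h) = h.
Proof. by move=> e z h; rewrite (comp_eql e) cmp1m. Qed.

Lemma split_mono (a b : A) (g : hom b a) (f : hom a b) :
  g ∘ f = idm a -> forall z (h k : hom z a), f ∘ h = f ∘ k -> h = k.
Proof. by move=> e z h k E; rewrite -(comp_idl e h) E comp_idl. Qed.

Lemma split_epi (a b : A) (g : hom b a) (f : hom a b) :
  g ∘ f = idm a -> forall z (h k : hom a z), h ∘ g = k ∘ g -> h = k.
Proof.
by move=> e z h k E; rewrite -(cmpm1 h) -(cmpm1 k) -e !cmpA E.
Qed.

End CategoryLemmas.

(** * Unit coherence in a monoidal category *)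
Section Coherence.
Variable X : ncscheme.
Implicit Types a b c d : X.

Lemma tenM a a' a'' b b' b'' (g : hom a' a'') (f : hom a a')
    (k : hom b' b'') (h : hom b b') :
  (g \oxm k) ∘ (f \oxm h) = (g ∘ f) \oxm (k ∘ h).
Proof. by rewrite -!cmpE /tenm tmorM. Qed.

Lemma ten1 a b : idm a \oxm idm b = idm (a \ox b).
Proof. exact: tmor1. Qed.

Lemma tenlM a b b' b'' (g : hom b' b'') (f : hom b b') :
  (a \oxl g) ∘ (a \oxl f) = a \oxl (g ∘ f).
Proof. by rewrite tenM cmp1m. Qed.

Lemma tenrM a a' a'' b (g : hom a' a'') (f : hom a a') :
  (g \oxm idm b) ∘ (f \oxm idm b) = (g ∘ f) \oxm idm b.
Proof. by rewrite tenM cmp1m. Qed.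

Lemma ten_swap a a' b b' (f : hom a a') (g : hom b b') :
  (f \oxm idm b') ∘ (a \oxl g) = (a' \oxl g) ∘ (f \oxm idm b).
Proof. by rewrite !tenM !cmp1m !cmpm1. Qed.

Lemma ascK a b c : asc' a b c ∘ asc a b c = idm _.
Proof. exact: iso_fwd_cmp. Qed.
Lemma asc'K a b c : asc a b c ∘ asc' a b c = idm _.
Proof. exact: iso_bwd_cmp. Qed.
Lemma lunK a : lun' a ∘ lun a = idm _.
Proof. exact: iso_fwd_cmp. Qed.
Lemma lun'K a : lun a ∘ lun' a = idm _.
Proof. exact: iso_bwd_cmp. Qed.
Lemma runK a : run' a ∘ run a = idm _.
Proof. exact: iso_fwd_cmp. Qed.
Lemma run'K a : run a ∘ run' a = idm _.
Proof. exact: iso_bwd_cmp. Qed.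

Lemma asc_natural a a' b b' c c' (f : hom a a') (g : hom b b') (h : hom c c') :
  asc a' b' c' ∘ ((f \oxm g) \oxm h) = (f \oxm (g \oxm h)) ∘ asc a b c.
Proof. by rewrite -!cmpE; apply: assoc_nat. Qed.

Lemma asc'_natural a a' b b' c c' (f : hom a a') (g : hom b b') (h : hom c c') :
  asc' a' b' c' ∘ (f \oxm (g \oxm h)) = ((f \oxm g) \oxm h) ∘ asc' a b c.
Proof.
apply: (split_mono (ascK _ _ _)).
by rewrite (comp_idl (asc'K _ _ _)) cmpA asc_natural -cmpA asc'K cmpm1.
Qed.

Lemma asc_natl a b c c' (h : hom c c') :
  asc a b c' ∘ ((a \ox b) \oxl h) = (a \oxl b \oxl h) ∘ asc a b c.
Proof. by rewrite -ten1 asc_natural. Qed.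

Lemma asc'_natl a b c c' (h : hom c c') :
  asc' a b c' ∘ (a \oxl b \oxl h) = ((a \ox b) \oxl h) ∘ asc' a b c.
Proof. by rewrite asc'_natural ten1. Qed.

Lemma asc_natr a a' b c (f : hom a a') :
  asc a' b c ∘ ((f \oxm idm b) \oxm idm c) =
  (f \oxm idm (b \ox c)) ∘ asc a b c.
Proof. by rewrite asc_natural ten1. Qed.

Lemma lun_natural a a' (f : hom a a') : lun a' ∘ (OO X \oxl f) = f ∘ lun a.
Proof. by rewrite -!cmpE; apply: lunit_nat. Qed.

Lemma run_natural a a' (f : hom a a') :
  run a' ∘ (f \oxm idm (OO X)) = f ∘ run a.
Proof. by rewrite -!cmpE; apply: runit_nat. Qed.

Lemma lun'_natural a a' (f : hom a a') : lun' a' ∘ f = (OO X \oxl f) ∘ lun' a.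
Proof.
apply: (split_mono (lunK _)).
by rewrite (comp_idl (lun'K _)) cmpA lun_natural -cmpA lun'K cmpm1.
Qed.

Lemma run'_natural a a' (f : hom a a') :
  run' a' ∘ f = (f \oxm idm (OO X)) ∘ run' a.
Proof.
apply: (split_mono (runK _)).
by rewrite (comp_idl (run'K _)) cmpA run_natural -cmpA run'K cmpm1.
Qed.

Lemma pentagonE a b c d :
  asc a b (c \ox d) ∘ asc (a \ox b) c d =
  (a \oxl asc b c d) ∘ (asc a (b \ox c) d ∘ (asc a b c \oxm idm d)).
Proof. by rewrite -!cmpE; apply: pentagon. Qed.

Lemma triangleE a b : (a \oxl lun b) ∘ asc a (OO X) b = run a \oxm idm b.
Proof. by rewrite -!cmpE; apply: triangle. Qed.

Lemma unit_faithfull a b (f g : hom a b) : OO X \oxl f = OO X \oxl g -> f = g.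
Proof.
by move=> e; apply: (split_epi (lun'K _)); rewrite -!lun_natural e.
Qed.

Lemma unit_faithfulr a b (f g : hom a b) :
  f \oxm idm (OO X) = g \oxm idm (OO X) -> f = g.
Proof.
by move=> e; apply: (split_epi (run'K _)); rewrite -!run_natural e.
Qed.

(** Kelly's argument: after tensoring with the unit on the left, the claim
    follows from the pentagon for [1, 1, a, b] and two triangles. *)
Lemma lun_ten a b : lun (a \ox b) ∘ asc (OO X) a b = lun a \oxm idm b.
Proof.
apply: unit_faithfull; rewrite -tenlM.
have e : (asc (OO X) (OO X \ox a) b ∘ (asc (OO X) (OO X) a \oxm idm b)) ∘
  ((asc' (OO X) (OO X) a \oxm idm b) ∘ asc' (OO X) (OO X \ox a) b) = idm _.
  by rewrite -cmpA (comp_eql (tenrM _ _ _)) asc'K ten1 cmp1m asc'K.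
apply: (split_epi e).
rewrite -cmpA -pentagonE (comp_eql (triangleE _ _)) -ten1 -asc_natural -triangleE.
by rewrite -tenrM (comp_eql (asc_natural _ _ _)) !cmpA.
Qed.

(** The mirror image of [lun_ten], from the pentagon for [a, b, 1, 1]. *)
Lemma run_ten a b : (a \oxl run b) ∘ asc a b (OO X) = run (a \ox b).
Proof.
apply: unit_faithfulr; apply: (split_mono (ascK _ _ _)).
rewrite -tenrM (comp_eql (asc_natural _ _ _)) -triangleE -tenlM -!cmpA -pentagonE.
by rewrite -triangleE [in RHS]cmpA asc_natl -!cmpA.
Qed.

Lemma run'_ten a b : asc a b (OO X) ∘ run' (a \ox b) = a \oxl run' b.
Proof.
have K : (a \oxl run' b) ∘ (a \oxl run b) = idm _ by rewrite tenlM runK ten1.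
by apply: (split_mono K); rewrite cmpA run_ten run'K tenlM run'K ten1.
Qed.

Lemma lun_unit : lun (OO X) = run (OO X).
Proof.
apply: unit_faithfulr; rewrite -lun_ten -triangleE; congr (_ ∘ _).
by apply: (split_mono (lunK _)); rewrite lun_natural.
Qed.

Lemma lun'_unit : lun' (OO X) = run' (OO X).
Proof.
apply: (split_mono (lunK _)).
by rewrite lun'K lun_unit run'K.
Qed.

End Coherence.

(** * The coalgebra [C] *)
Section CoalgebraAxioms.
Variables (X S : ncscheme) (p : ncmorphism X S).

Local Notation C := (coalg p).
Local Notation eta := (adj_unit (pull_push p) (OO S)).
Local Notation mu := (lax_mul (push_lax p)).

Lemma adj_unit_natural (y y' : S) (f : hom y y') :
  adj_unit (pull_push p) y' ∘ f =
  fmor (push p) (fmor (pull p) f) ∘ adj_unit (pull_push p) y.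
Proof. by rewrite -!cmpE adj_unit_nat. Qed.

Lemma transpose_inj (y : S) (x : X) (f g : hom (pull p y) x) :
  fmor (push p) f ∘ adj_unit (pull_push p) y =
  fmor (push p) g ∘ adj_unit (pull_push p) y -> f = g.
Proof.
have K (h : hom (pull p y) x) : h = adj_counit (pull_push p) x ∘
    fmor (pull p) (fmor (push p) h ∘ adj_unit (pull_push p) y).
  rewrite -!cmpE fmorM compmA -(adj_counit_nat (pull_push p)) -compmA.
  by rewrite (adj_triangleL (pull_push p)) compm1.
by move=> e; rewrite (K f) (K g) e.
Qed.

(** [eps o p^* f] is the transpose of [f]; with [transpose_inj], maps out of
    [p^* y] are determined by, and computed through, their transposes. *)
Lemma transposeE (y : S) (x : X) (f : hom y (push p x)) :
  fmor (push p) (adj_counit (pull_push p) x ∘ fmor (pull p) f) ∘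
    adj_unit (pull_push p) y = f.
Proof.
rewrite fmor_cmp -cmpA -adj_unit_natural -!cmpE compmA.
by rewrite (adj_triangleR (pull_push p)) comp1m.
Qed.

Lemma comul_transpose :
  fmor (push p) (comul p) ∘ eta = mu C C ∘ ((eta \oxm eta) ∘ lun' (OO S)).
Proof.
rewrite /comul cmpE (fmor_cmp (push p)) -cmpA -adj_unit_natural cmpA.
by rewrite /colax_mul cmpE transposeE cmpE -cmpA.
Qed.

Lemma counit_transpose :
  fmor (push p) (counit p) ∘ eta = lax_unit (push_lax p).
Proof. by rewrite /counit /colax_unit cmpE transposeE. Qed.

Lemma lax_mul_natr (a a' b : X) (f : hom a a') y (h : hom y _) :
  fmor (push p) (f \oxm idm b) ∘ (mu a b ∘ h) =
  mu a' b ∘ ((fmor (push p) f \oxm idm _) ∘ h).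
Proof. by rewrite -!cmpE !compmA -(fmor1 (push p) b) lax_mul_nat. Qed.

Lemma lax_mul_natl (a b b' : X) (f : hom b b') y (h : hom y _) :
  fmor (push p) (a \oxl f) ∘ (mu a b ∘ h) =
  mu a b' ∘ ((push p a \oxl fmor (push p) f) ∘ h).
Proof. by rewrite -!cmpE !compmA -(fmor1 (push p) a) lax_mul_nat. Qed.

(** Both sides have transposes that are iterated multiplications of the lax
    functor [p_*] applied to [eta (x) eta (x) eta]; they agree because [p_*] is
    lax associative and the two ways of splitting the unit of [S] agree. *)
Lemma comul_coassoc :
  (C \oxl comul p) ∘ comul p = asc C C C ∘ ((comul p \oxm idm C) ∘ comul p).
Proof.
apply: transpose_inj; rewrite !fmor_cmp -!cmpA comul_transpose.
rewrite lax_mul_natl lax_mul_natr !(comp_eql (tenM _ _ _ _)) !cmp1m.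
rewrite comul_transpose.
have -> : (mu C C ∘ ((eta \oxm eta) ∘ lun' (OO S))) \oxm eta =
  (mu C C \oxm idm _) ∘ (((eta \oxm eta) \oxm eta) ∘ (lun' (OO S) \oxm idm _)).
  by rewrite !tenM cmp1m cmpm1.
have -> : eta \oxm (mu C C ∘ ((eta \oxm eta) ∘ lun' (OO S))) =
  (_ \oxl mu C C) ∘ ((eta \oxm (eta \oxm eta)) ∘ (_ \oxl lun' (OO S))).
  by rewrite !tenM cmp1m cmpm1.
have -> : OO S \oxl lun' (OO S) =
    asc (OO S) (OO S) (OO S) ∘ (lun' (OO S) \oxm idm (OO S)).
  rewrite lun'_unit.
  have eK : (OO S \oxl lun (OO S)) ∘ (OO S \oxl lun' (OO S)) = idm _.
    by rewrite tenlM lun'K ten1.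
  apply: (@split_mono _ _ _ (OO S \oxl lun' (OO S)) (OO S \oxl lun (OO S))).
    by rewrite tenlM lunK ten1.
  rewrite (comp_eql (triangleE _ _)) -lun'_unit eK lun'_unit.
  by rewrite tenrM run'K ten1.
have := @lax_assoc _ _ _ (push_lax p) C C C; rewrite !cmpE => /comp_eql L.
rewrite -!cmpA [mu (C \ox C) C ∘ (_ ∘ _)]cmpA L -!cmpA.
by rewrite (comp_eql (asc_natural _ _ _)) -!cmpA.
Qed.

(** The transpose of the counit is the unit of [p_*], so this is the left unit
    law of the lax functor. *)
Lemma comul_counitl : lun C ∘ ((counit p \oxm idm C) ∘ comul p) = idm C.
Proof.
apply: transpose_inj; rewrite !fmor_cmp -!cmpA comul_transpose.
rewrite lax_mul_natr (comp_eql (tenM _ _ _ _)) cmp1m counit_transpose.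
have -> : lax_unit (push_lax p) \oxm eta =
   (lax_unit (push_lax p) \oxm idm _) ∘ (_ \oxl eta).
  by rewrite tenM cmp1m cmpm1.
have := @lax_lunit _ _ _ (push_lax p) C; rewrite !cmpE => /comp_eql L.
rewrite -!cmpA [mu (OO X) C ∘ (_ ∘ _)]cmpA L.
by rewrite -lun'_natural (comp_idl (lun'K _)) fmor1 cmp1m.
Qed.

Lemma comul_counitr : run C ∘ ((C \oxl counit p) ∘ comul p) = idm C.
Proof.
apply: transpose_inj; rewrite !fmor_cmp -!cmpA comul_transpose.
rewrite lax_mul_natl (comp_eql (tenM _ _ _ _)) cmp1m counit_transpose.
have -> : eta \oxm lax_unit (push_lax p) =
   (_ \oxl lax_unit (push_lax p)) ∘ (eta \oxm idm _).
  by rewrite tenM cmp1m cmpm1.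
have := @lax_runit _ _ _ (push_lax p) C; rewrite !cmpE => /comp_eql L.
rewrite -!cmpA [mu C (OO X) ∘ (_ ∘ _)]cmpA L lun'_unit -run'_natural.
by rewrite (comp_idl (run'K _)) fmor1 cmp1m.
Qed.

End CoalgebraAxioms.

(** * Extending maps by a tail *)
Definition invertible (A : category) (a b : A) (f : hom a b) : Prop :=
  exists g, g ∘ f = idm a /\ f ∘ g = idm b.

Lemma invertible_mono (A : category) (a b : A) (f : hom a b) :
  invertible f -> forall c (g h : hom c a), f ∘ g = f ∘ h -> g = h.
Proof. by case=> f' [f'K _] c g h; apply: split_mono f'K _ _ _. Qed.

Lemma invertible_epi (A : category) (a b : A) (f : hom a b) :
  invertible f -> forall c (g h : hom b c), g ∘ f = h ∘ f -> g = h.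
Proof. by case=> f' [_ fK] c g h; apply: split_epi fK _ _ _. Qed.

Lemma fmor_invertible (A B : category) (F : functor A B) (a b : A) (f : hom a b) :
  invertible f -> invertible (fmor F f).
Proof.
by case=> g [gK fK]; exists (fmor F g); rewrite -!fmor_cmp gK fK !fmor1.
Qed.

Section PentagonForms.
Variable X : ncscheme.

Lemma pentagon_fuse (a b c d e : X) (h : hom e _) :
  (a \oxl asc b c d) ∘ (asc a (b \ox c) d ∘ ((asc a b c \oxm idm d) ∘ h)) =
  asc a b (c \ox d) ∘ (asc (a \ox b) c d ∘ h).
Proof. by rewrite [RHS]cmpA pentagonE -!cmpA. Qed.

(** The pentagon with one associator moved to the other side, as needed when a
    word is extended while another factor is split off. *)
Lemma pentagon_slide (a b c d : X) :
  asc' a b (c \ox d) ∘ ((a \oxl asc b c d) ∘ asc a (b \ox c) d) =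
  asc (a \ox b) c d ∘ (asc' a b c \oxm idm d).
Proof.
apply: (split_mono (ascK a b (c \ox d))).
rewrite (comp_idl (asc'K _ _ _)) -pentagon_fuse tenrM asc'K ten1 cmpm1 //.
Qed.

Lemma pentagon_slide' (a b c d e : X) (h : hom e _) :
  asc a (b \ox c) d ∘ ((asc a b c \oxm idm d) ∘ (asc' (a \ox b) c d ∘ h)) =
  (a \oxl asc' b c d) ∘ (asc a b (c \ox d) ∘ h).
Proof.
have K : (a \oxl asc' b c d) ∘ (a \oxl asc b c d) = idm _.
  by rewrite tenlM ascK ten1.
by rewrite -(comp_idl K (asc a _ d ∘ _)) pentagon_fuse (comp_idl (asc'K _ _ _)).
Qed.

End PentagonForms.

Section Lifts.
Variables (X : ncscheme) (U : X).

(** [r] and [s] reassociate the source and the target, bringing the tail [U]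
    inside the right-bracketed words [a'] and [b']. *)
Definition lifts (a a' b b' : X) (r : hom (a \ox U) a') (s : hom (b \ox U) b')
    (f : hom a b) (g : hom a' b') : Prop :=
  s ∘ (f \oxm idm U) = g ∘ r.

(** Reassociation is built up one left factor at a time, so that all the
    reassociations below are iterates of this step. *)
Definition ext (c a a' : X) (r : hom (a \ox U) a') :
  hom ((c \ox a) \ox U) (c \ox a') := (c \oxl r) \o asc c a U.

Lemma ext1 (c a : X) : ext c (idm (a \ox U)) = asc c a U.
Proof. by rewrite /ext !cmpE ten1 cmp1m. Qed.

Lemma ext_invertible (c a a' : X) (r : hom (a \ox U) a') :
  invertible r -> invertible (ext c r).
Proof.
case=> s [sK rK]; exists (asc' c a U ∘ (c \oxl s)); rewrite /ext !cmpE; split.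
  by rewrite -!cmpA (comp_eql (tenlM _ _ _)) sK ten1 cmp1m ascK.
by rewrite -!cmpA (comp_idl (asc'K _ _ _)) tenlM rK ten1.
Qed.

Lemma invertible1 (A : category) (a : A) : invertible (idm a).
Proof. by exists (idm a); rewrite cmp1m. Qed.

Lemma lifts1 (a a' : X) (r : hom (a \ox U) a') : lifts r r (idm a) (idm a').
Proof. by rewrite /lifts ten1 cmp1m cmpm1. Qed.

Lemma lifts_comp (a a' b b' c c' : X) (r : hom (a \ox U) a')
    (s : hom (b \ox U) b') (t : hom (c \ox U) c')
    (f : hom a b) (f' : hom a' b') (g : hom b c) (g' : hom b' c') :
  lifts s t g g' -> lifts r s f f' -> lifts r t (g ∘ f) (g' ∘ f').
Proof.
by rewrite /lifts => eg ef; rewrite -tenrM cmpA eg -cmpA ef cmpA.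
Qed.

Lemma lifts_ten (c a a' b b' : X) (r : hom (a \ox U) a') (s : hom (b \ox U) b')
    (f : hom a b) (f' : hom a' b') :
  lifts r s f f' -> lifts (ext c r) (ext c s) (c \oxl f) (c \oxl f').
Proof.
rewrite /lifts /ext !cmpE => e.
by rewrite -cmpA asc_natural cmpA tenlM e -tenlM -cmpA.
Qed.

Lemma lifts_eq (a a' b b' : X) (r : hom (a \ox U) a') (s : hom (b \ox U) b')
    (f g : hom a b) (f' g' : hom a' b') :
  invertible r -> lifts r s f f' -> lifts r s g g' -> f = g -> f' = g'.
Proof.
rewrite /lifts => ri ef eg e.
by apply: (invertible_epi ri); rewrite -ef -eg e.
Qed.

(** The converse of [lifts_eq] that survives under a functor: it cannot reach
    [f = g] itself, as nothing allows [U] to be cancelled. *)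
Lemma lifts_fmor (B : category) (F : functor X B) (a a' b b' : X)
    (r : hom (a \ox U) a') (s : hom (b \ox U) b')
    (f g : hom a b) (f' g' : hom a' b') :
  invertible s -> lifts r s f f' -> lifts r s g g' ->
  fmor F f' = fmor F g' -> fmor F (f \oxm idm U) = fmor F (g \oxm idm U).
Proof.
rewrite /lifts => si ef eg e; apply: (invertible_mono (fmor_invertible F si)).
by rewrite -!fmor_cmp ef eg !fmor_cmp e.
Qed.

End Lifts.

Section HeadMaps.
Variable X : ncscheme.

(** A map between binary products, acting on the first two factors of a word;
    the braiding and its inverse are the two instances. *)
Definition headT (a b a' b' : X) (f : hom (a \ox b) (a' \ox b')) (U : X) :
    hom (a \ox b \ox U) (a' \ox b' \ox U) :=
  asc a' b' U \o ((f \oxm idm U) \o asc' a b U).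

Variables (a b a' b' : X) (f : hom (a \ox b) (a' \ox b')).

Lemma headT_natural (U V : X) (g : hom U V) :
  headT f V ∘ (a \oxl b \oxl g) = (a' \oxl b' \oxl g) ∘ headT f U.
Proof.
rewrite /headT !cmpE -!cmpA asc'_natl (comp_eql (ten_swap _ _)) -!cmpA.
by rewrite (comp_eql (asc_natl _ _ _)) -!cmpA.
Qed.

Lemma lifts_headT0 (U : X) :
  lifts (ext a (idm (b \ox U))) (ext a' (idm (b' \ox U))) f (headT f U).
Proof. by rewrite /lifts !ext1 /headT !cmpE -!cmpA ascK cmpm1. Qed.

(** Acting on the head of [a (x) b (x) V] and then appending [U] is acting on the
    head of the longer word, by two pentagons. *)
Lemma lifts_headT (U V W : X) (r : hom (V \ox U) W) :
  lifts (ext a (ext b r)) (ext a' (ext b' r)) (headT f V) (headT f W).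
Proof.
rewrite /lifts /ext /headT !cmpE -!tenrM -!tenlM -!cmpA pentagon_fuse.
rewrite (comp_eql (asc_natr _ _ _)) -!cmpA -pentagon_slide.
rewrite (comp_eql (asc'_natl _ _ _)) -!cmpA (comp_eql (ten_swap _ _)) -!cmpA.
by rewrite (comp_eql (asc_natl _ _ _)) -!cmpA.
Qed.

End HeadMaps.

Section TailOperators.
Variables (X S : ncscheme) (p : ncmorphism X S).

Local Notation C := (coalg p).

Lemma comulTE U : comulT p U = asc C C U ∘ (comul p \oxm idm U).
Proof. exact: cmpE. Qed.

Lemma counitTE U : counitT p U = lun U ∘ (counit p \oxm idm U).
Proof. exact: cmpE. Qed.

Lemma comulT_natural (U V : X) (f : hom U V) :
  comulT p V ∘ (C \oxl f) = (C \oxl C \oxl f) ∘ comulT p U.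
Proof. by rewrite !comulTE -!cmpA ten_swap (comp_eql (asc_natl _ _ _)) -!cmpA. Qed.

Lemma counitT_natural (U V : X) (f : hom U V) :
  counitT p V ∘ (C \oxl f) = f ∘ counitT p U.
Proof.
by rewrite !counitTE -!cmpA ten_swap (comp_eql (lun_natural _)) -!cmpA.
Qed.

Lemma lifts_comul (U : X) :
  lifts (idm (C \ox U)) (ext C (idm (C \ox U))) (comul p) (comulT p U).
Proof. by rewrite /lifts ext1 cmpm1 comulTE. Qed.

Lemma lifts_comulT (U V W : X) (r : hom (V \ox U) W) :
  lifts (ext C r) (ext C (ext C r)) (comulT p V) (comulT p W).
Proof.
rewrite /lifts /ext !cmpE !comulTE -!tenrM -!tenlM -!cmpA pentagon_fuse asc_natr.
by rewrite (comp_eql (ten_swap _ _)) -!cmpA (comp_eql (asc_natl _ _ _)) -!cmpA.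
Qed.

Lemma lifts_counitT (U V W : X) (r : hom (V \ox U) W) :
  lifts (ext C r) r (counitT p V) (counitT p W).
Proof.
rewrite /lifts /ext !cmpE !counitTE -!tenrM -lun_ten -!cmpA asc_natr.
by rewrite (comp_eql (ten_swap _ _)) -!cmpA (comp_eql (lun_natural _)) -!cmpA.
Qed.

Lemma lifts_counitr (a U : X) :
  lifts (ext a (idm (C \ox U))) (idm (a \ox U))
    (run a ∘ (a \oxl counit p)) (a \oxl counitT p U).
Proof.
rewrite /lifts ext1 cmp1m counitTE -tenrM -triangleE -tenlM -!cmpA.
by rewrite asc_natural.
Qed.

(** The coalgebra laws pass to words by tensoring with the tail. *)
Lemma comulT_coassoc U :
  (C \oxl comulT p U) ∘ comulT p U = comulT p (C \ox U) ∘ comulT p U.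
Proof.
have e := comul_coassoc p; rewrite cmpA -comulTE in e.
apply: lifts_eq (@invertible1 X _) _ _ e; apply: lifts_comp (lifts_comul U).
  exact/lifts_ten/lifts_comul.
exact: lifts_comulT.
Qed.

Lemma comulT_counitl U : counitT p (C \ox U) ∘ comulT p U = idm (C \ox U).
Proof.
have e := comul_counitl p; rewrite cmpA -counitTE in e.
apply: lifts_eq (@invertible1 X _) _ (lifts1 _) e.
exact: lifts_comp (lifts_counitT _) (lifts_comul U).
Qed.

Lemma comulT_counitr U : (C \oxl counitT p U) ∘ comulT p U = idm (C \ox U).
Proof.
have e := comul_counitr p; rewrite cmpA in e.
apply: lifts_eq (@invertible1 X _) _ (lifts1 _) e.
exact: lifts_comp (lifts_counitr _ _) (lifts_comul U).
Qed.

Section Braiding.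
Variables (M : X) (b : braiding p M).

Lemma braidTE U : braidT b U = headT (iso_fwd b) U.
Proof. by []. Qed.

Lemma braidT'E U : braidT' b U = headT (iso_bwd b) U.
Proof. by []. Qed.

Lemma braidTK U : braidT' b U ∘ braidT b U = idm _.
Proof.
rewrite braidTE braidT'E /headT !cmpE -!cmpA (comp_idl (ascK _ _ _)).
by rewrite (comp_eql (tenrM _ _ _)) iso_fwd_cmp ten1 cmp1m asc'K.
Qed.

Lemma braidT'K U : braidT b U ∘ braidT' b U = idm _.
Proof.
rewrite braidTE braidT'E /headT !cmpE -!cmpA (comp_idl (ascK _ _ _)).
by rewrite (comp_eql (tenrM _ _ _)) iso_bwd_cmp ten1 cmp1m asc'K.
Qed.

Lemma braidT_natural (U V : X) (f : hom U V) :
  braidT b V ∘ (C \oxl M \oxl f) = (M \oxl C \oxl f) ∘ braidT b U.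
Proof. by rewrite !braidTE headT_natural. Qed.

Lemma braidT'_natural (U V : X) (f : hom U V) :
  braidT' b V ∘ (M \oxl C \oxl f) = (C \oxl M \oxl f) ∘ braidT' b U.
Proof. by rewrite !braidT'E headT_natural. Qed.

Lemma lifts_braid (U : X) :
  lifts (ext C (idm (M \ox U))) (ext M (idm (C \ox U))) (iso_fwd b) (braidT b U).
Proof. by rewrite braidTE; apply: lifts_headT0. Qed.

Lemma lifts_braid' (U : X) :
  lifts (ext M (idm (C \ox U))) (ext C (idm (M \ox U))) (iso_bwd b) (braidT' b U).
Proof. by rewrite braidT'E; apply: lifts_headT0. Qed.

Lemma lifts_braidT (U V W : X) (r : hom (V \ox U) W) :
  lifts (ext C (ext M r)) (ext M (ext C r)) (braidT b V) (braidT b W).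
Proof. by rewrite !braidTE; apply: lifts_headT. Qed.

Lemma lifts_braidT' (U V W : X) (r : hom (V \ox U) W) :
  lifts (ext M (ext C r)) (ext C (ext M r)) (braidT' b V) (braidT' b W).
Proof. by rewrite !braidT'E; apply: lifts_headT. Qed.

End Braiding.
End TailOperators.

(** * The axioms on words with a tail *)
Section TailForms.
Variables (X S : ncscheme) (p : ncmorphism X S) (M : X) (b : braiding p M).

Local Notation C := (coalg p).
Local Notation beta := (iso_fwd b).
Local Notation beta' := (iso_bwd b).

(** The equation [f' = g'] is [f = g] tensored with [U], up to the same
    reassociations on both sides. *)
Definition tail_form (U a a' c c' : X) (f g : hom a c) (f' g' : hom a' c') :=
  exists (r : hom (a \ox U) a') (s : hom (c \ox U) c'),
    [/\ invertible r, invertible s, lifts r s f f' & lifts r s g g'].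

Lemma tail_form_eq (U a a' c c' : X) (f g : hom a c) (f' g' : hom a' c') :
  tail_form U f g f' g' -> f = g -> f' = g'.
Proof. by case=> r [s [ri si lf lg]]; apply: lifts_eq ri lf lg. Qed.

Lemma tail_form_fmor (U a a' c c' : X) (f g : hom a c) (f' g' : hom a' c')
    (B : category) (F : functor X B) :
  tail_form U f g f' g' -> fmor F f' = fmor F g' ->
  fmor F (f \oxm idm U) = fmor F (g \oxm idm U).
Proof. by case=> r [s [ri si lf lg]]; apply: lifts_fmor si lf lg. Qed.

(** The lift of a composite is found by lifting its factors one at a time; the
    reassociations between them are determined by unification. *)
Ltac lift_composite := repeat
  (first [ apply: lifts_braid | apply: lifts_braid' | apply: lifts_comul
         | apply: lifts_braidT | apply: lifts_braidT' | apply: lifts_comulT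
         | apply: lifts_counitT | apply: lifts_ten
         | apply: lifts_comp]).

Ltac invert_ext := repeat (first [apply: invertible1 | apply: ext_invertible]).

Lemma tail_I U : tail_form U
  ((M \oxl comulT p C) ∘ braidT b C ∘ (C \oxl beta))
  (braidT b (C \ox C) ∘ (C \oxl braidT b C) ∘ (C \oxl C \oxl beta) ∘
    (C \oxl comulT p M))
  ((M \oxl comulT p (C \ox U)) ∘ braidT b (C \ox U) ∘ (C \oxl braidT b U))
  (braidT b (C \ox C \ox U) ∘ (C \oxl braidT b (C \ox U)) ∘
    (C \oxl C \oxl braidT b U) ∘ (C \oxl comulT p (M \ox U))).
Proof. by do 2!eexists; split; last first; lift_composite; invert_ext. Qed.

Lemma tail_II U : tail_form U
  ((C \oxl braidT b C) ∘ comulT p (M \ox C) ∘ braidT' b C ∘ (M \oxl comul p))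
  ((C \oxl M \oxl comul p) ∘ (C \oxl beta) ∘ comulT p M ∘ beta')
  ((C \oxl braidT b (C \ox U)) ∘ comulT p (M \ox C \ox U) ∘ braidT' b (C \ox U)
    ∘ (M \oxl comulT p U))
  ((C \oxl M \oxl comulT p U) ∘ (C \oxl braidT b U) ∘ comulT p (M \ox U) ∘
    braidT' b U).
Proof. by do 2!eexists; split; last first; lift_composite; invert_ext. Qed.

Lemma tail_III U : tail_form U
  ((C \oxl beta') ∘ (C \oxl M \oxl counitT p C) ∘ (C \oxl braidT b C) ∘
      comulT p (M \ox C))
  (comulT p M ∘ beta' ∘ (M \oxl counitT p C) ∘ braidT b C)
  ((C \oxl braidT' b U) ∘ (C \oxl M \oxl counitT p (C \ox U)) ∘
     (C \oxl braidT b (C \ox U)) ∘ comulT p (M \ox C \ox U))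
  (comulT p (M \ox U) ∘ braidT' b U ∘ (M \oxl counitT p (C \ox U)) ∘
     braidT b (C \ox U)).
Proof. by do 2!eexists; split; last first; lift_composite; invert_ext. Qed.

Lemma tail_IV U : tail_form U
  beta
  ((M \oxl counitT p C) ∘ braidT b C ∘ (C \oxl beta) ∘ comulT p M)
  (braidT b U)
  ((M \oxl counitT p (C \ox U)) ∘ braidT b (C \ox U) ∘ (C \oxl braidT b U) ∘
     comulT p (M \ox U)).
Proof. by do 2!eexists; split; last first; lift_composite; invert_ext. Qed.

Lemma tail_VI U : tail_form U
  (beta ∘ (C \oxl counitT p M))
  ((M \oxl counitT p C) ∘ braidT b C ∘ (C \oxl beta))
  (braidT b U ∘ (C \oxl counitT p (M \ox U)))
  ((M \oxl counitT p (C \ox U)) ∘ braidT b (C \ox U) ∘ (C \oxl braidT b U)).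
Proof. by do 2!eexists; split; last first; lift_composite; invert_ext. Qed.

Lemma counitRE : counitR p M = run M ∘ (M \oxl counit p).
Proof. exact: cmpE. Qed.

(** With a trivial tail the braiding of words is the braiding itself. *)
Lemma braid_unit : beta ∘ (C \oxl run M) = (M \oxl run C) ∘ braidT b (OO X).
Proof.
rewrite braidTE /headT !cmpE cmpA run_ten cmpA run_natural -cmpA -run_ten -cmpA.
by rewrite asc'K cmpm1.
Qed.

Lemma counit_counit :
  counit p ∘ counitT p C = counit p ∘ (run C ∘ (C \oxl counit p)).
Proof.
rewrite counitTE !cmpA -lun_natural -run_natural -lun_unit -!cmpA.
by rewrite ten_swap.
Qed.

(** Composing VI with the counit on the remaining [C] gives V, up to the order
    in which the two counits are applied ([counit_counit]). *)
Lemma axiom_V_of_VI :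
  beta ∘ (C \oxl counitT p M) =
    (M \oxl counitT p C) ∘ braidT b C ∘ (C \oxl beta) ->
  counitR p M ∘ beta ∘ (C \oxl counitT p M) =
  counitR p M ∘ beta ∘ (C \oxl counitR p M) ∘ (C \oxl beta).
Proof.
move=> VI; rewrite -!cmpA VI !cmpA; congr (_ ∘ _).
rewrite !counitRE -tenlM -!cmpA (comp_eql braid_unit) -!cmpA braidT_natural.
by rewrite !(comp_eql (tenlM _ _ _)) -cmpA -counit_counit.
Qed.

End TailForms.

(** * Flips *)
Section Flips.
Variables (X : ncscheme) (Tr : trace_functor X).

Lemma flip_natural (a a' b b' : X) (f : hom a a') (g : hom b b') :
  flip Tr a' b' ∘ fmor Tr (f \oxm g) = fmor Tr (g \oxm f) ∘ flip Tr a b.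
Proof. by rewrite -!cmpE flip_nat. Qed.

Lemma flip_flip (a b : X) : flip Tr b a ∘ flip Tr a b = idm (Tr (a \ox b)).
Proof. by rewrite -cmpE flipK. Qed.

Lemma flip_past_pair (a b c : X) :
  flip Tr a (b \ox c) =
    fmor Tr (asc' b c a) ∘ (flip Tr (c \ox a) b ∘
      (fmor Tr (asc' c a b) ∘ (flip Tr (a \ox b) c ∘ fmor Tr (asc' a b c)))).
Proof. by rewrite -!cmpE; apply: flip_cycle. Qed.

(** The flip past the unit object, seen as an endomorphism of [Tr a]. *)
Definition unit_loop (a : X) : hom (Tr a) (Tr a) :=
  fmor Tr (lun a) \o (flip Tr a (OO X) \o fmor Tr (run' a)).

Lemma unit_loopE a :
  fmor Tr (lun a) ∘ flip Tr a (OO X) = unit_loop a ∘ fmor Tr (run a).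
Proof. by rewrite /unit_loop !cmpE -!cmpA -fmor_cmp runK fmor1 cmpm1. Qed.

Lemma unit_loop_natural a a' (f : hom a a') :
  unit_loop a' ∘ fmor Tr f = fmor Tr f ∘ unit_loop a.
Proof.
rewrite /unit_loop !cmpE -!cmpA -fmor_cmp run'_natural fmor_cmp.
by rewrite (comp_eql (flip_natural _ _)) !cmpA -!fmor_cmp lun_natural.
Qed.

Lemma fmor_asc'K a b c : fmor Tr (asc a b c) ∘ fmor Tr (asc' a b c) = idm _.
Proof. by rewrite -fmor_cmp asc'K fmor1. Qed.

Lemma fmor_ascK a b c : fmor Tr (asc' a b c) ∘ fmor Tr (asc a b c) = idm _.
Proof. by rewrite -fmor_cmp ascK fmor1. Qed.

(** Flipping past [1 (x) 1] at once is one loop, and flipping past its two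
    factors in turn is two. *)
Lemma unit_loop_idem a : unit_loop a = unit_loop a ∘ unit_loop a.
Proof.
(* Both ways are compared as maps from [Tr (a (x) 1 (x) 1)], where [f] inverts
   the projection to [Tr a]. *)
have [f [fK Kf]] : invertible (fmor Tr (run a ∘ (a \oxl run (OO X)))).
  apply: fmor_invertible; exists ((a \oxl run' _) ∘ run' a).
  rewrite -!cmpA (comp_eql (tenlM _ _ _)) run'K ten1 cmp1m run'K.
  by rewrite (comp_idl (runK _)) tenlM runK ten1.
apply: (split_epi Kf).
have e : fmor Tr (lun a) ∘ (fmor Tr (lun (OO X) \oxm idm a) ∘
    flip Tr a (OO X \ox OO X)) = unit_loop a ∘ fmor Tr (run a ∘ (a \oxl run (OO X))).
  by rewrite -flip_natural cmpA unit_loopE fmor_cmp -cmpA lun_unit.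
rewrite -e flip_past_pair.
have -> : lun (OO X) \oxm idm a = lun (OO X \ox a) ∘ asc (OO X) (OO X) a.
  by rewrite lun_ten.
have -> : a \oxl run (OO X) = run (a \ox OO X) ∘ asc' a (OO X) (OO X).
  by rewrite -run_ten -cmpA asc'K cmpm1.
rewrite !fmor_cmp -!cmpA (comp_idl (fmor_asc'K _ _ _)).
rewrite (comp_eql (unit_loopE _)) -!cmpA.
rewrite (comp_eql (esym (unit_loop_natural (lun a)))) -!cmpA.
congr (_ ∘ _).
have -> : fmor Tr (lun a) ∘ (fmor Tr (run (OO X \ox a)) ∘
    (fmor Tr (asc' (OO X) a (OO X)) ∘ (flip Tr (a \ox OO X) (OO X) ∘
       fmor Tr (asc' a (OO X) (OO X))))) =
  fmor Tr (run a) ∘ (fmor Tr (lun (a \ox OO X)) ∘ (flip Tr (a \ox OO X) (OO X) ∘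
       fmor Tr (asc' a (OO X) (OO X)))).
  rewrite !cmpA -!fmor_cmp; congr (fmor _ _ ∘ _ ∘ _).
  by rewrite -run_natural -lun_ten -!cmpA asc'K cmpm1.
rewrite (comp_eql (unit_loopE _)) -!cmpA.
by rewrite (comp_eql (esym (unit_loop_natural (run a)))) -!cmpA.
Qed.

Lemma unit_loop1 a : unit_loop a = idm (Tr a).
Proof.
have [f [fK Kf]] : invertible (unit_loop a).
  exists (fmor Tr (run a) ∘ (flip Tr (OO X) a ∘ fmor Tr (lun' a))).
  rewrite /unit_loop !cmpE -!cmpA; split.
    rewrite (comp_eql (esym (fmor_cmp Tr (lun' a) (lun a)))) lunK fmor1 cmp1m.
    by rewrite (comp_idl (flip_flip _ _)) -fmor_cmp run'K fmor1.
  rewrite (comp_eql (esym (fmor_cmp Tr (run' a) (run a)))) runK fmor1 cmp1m.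
  by rewrite (comp_idl (flip_flip _ _)) -fmor_cmp lun'K fmor1.
by apply: (split_epi Kf); rewrite cmp1m -unit_loop_idem.
Qed.

Lemma flip_unit a : fmor Tr (lun a) ∘ flip Tr a (OO X) = fmor Tr (run a).
Proof. by rewrite unit_loopE unit_loop1 cmp1m. Qed.

End Flips.

(** * Moving the last factor to the front *)
Section Rotation.
Variables (X S : ncscheme) (p : ncmorphism X S) (Tr : trace_functor X) (M : X).

Local Notation C := (coalg p).
Local Notation phi := (last_to_front p Tr M).
Local Notation psi := (front_to_last p Tr M).
Local Notation T := (fmor Tr).

Lemma Cpow_snocS n : Cpow_snoc p n.+1 = ext C (Cpow_snoc p n).
Proof. by []. Qed.

Lemma CMC_snoc0 n : CMC_snoc p M 0 n = ext M (Cpow_snoc p n).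
Proof. by []. Qed.

Lemma CMC_snocS m n : CMC_snoc p M m.+1 n = ext C (CMC_snoc p M m n).
Proof. by []. Qed.

Lemma Cpow_snocK n : Cpow_unsnoc p n ∘ Cpow_snoc p n = idm _.
Proof.
elim: n => [|n IH].
  by rewrite /= !cmpE -!cmpA (comp_idl (run'K _)) lunK.
rewrite Cpow_snocS /= /ext !cmpE -!cmpA (comp_eql (tenlM _ _ _)) IH ten1.
by rewrite cmp1m ascK.
Qed.

Lemma Cpow_unsnocK n : Cpow_snoc p n ∘ Cpow_unsnoc p n = idm _.
Proof.
elim: n => [|n IH].
  by rewrite /= !cmpE -!cmpA (comp_idl (lun'K _)) runK.
rewrite Cpow_snocS /= /ext !cmpE -!cmpA (comp_idl (asc'K _ _ _)) tenlM IH.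
by rewrite ten1.
Qed.

Lemma CMC_snocK m n : CMC_unsnoc p M m n ∘ CMC_snoc p M m n = idm _.
Proof.
elim: m => [|m IH].
  rewrite CMC_snoc0 /= /ext !cmpE -!cmpA (comp_eql (tenlM _ _ _)) Cpow_snocK.
  by rewrite ten1 cmp1m ascK.
rewrite CMC_snocS /= /ext !cmpE -!cmpA (comp_eql (tenlM _ _ _)) IH ten1.
by rewrite cmp1m ascK.
Qed.

Lemma CMC_unsnocK m n : CMC_snoc p M m n ∘ CMC_unsnoc p M m n = idm _.
Proof.
elim: m => [|m IH].
  rewrite CMC_snoc0 /= /ext !cmpE -!cmpA (comp_idl (asc'K _ _ _)) tenlM.
  by rewrite Cpow_unsnocK ten1.
rewrite CMC_snocS /= /ext !cmpE -!cmpA (comp_idl (asc'K _ _ _)) tenlM IH.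
by rewrite ten1.
Qed.

Lemma last_to_frontE m n :
  phi m n = flip Tr (CMC p M m n) C ∘ T (CMC_unsnoc p M m n).
Proof. exact: cmpE. Qed.

Lemma front_to_lastE m n :
  psi m n = T (CMC_snoc p M m n) ∘ flip Tr C (CMC p M m n).
Proof. exact: cmpE. Qed.

Lemma last_to_frontK m n : psi m n ∘ phi m n = idm _.
Proof.
rewrite last_to_frontE front_to_lastE -!cmpA (comp_idl (flip_flip _ _ _)).
by rewrite -fmor_cmp CMC_unsnocK fmor1.
Qed.

Lemma front_to_lastK m n : phi m n ∘ psi m n = idm _.
Proof.
rewrite last_to_frontE front_to_lastE -!cmpA (comp_eql (esym (fmor_cmp Tr _ _))).
by rewrite CMC_snocK fmor1 cmp1m flip_flip.
Qed.

(** [f'] is [f] acting on a word with one more copy of [C] at its end; that copy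
    is the one that moves. *)
Lemma last_to_front_natural m n m' n' (f : hom (CMC p M m n) (CMC p M m' n'))
    (f' : hom (CMC p M m n.+1) (CMC p M m' n'.+1)) :
  lifts (CMC_snoc p M m n) (CMC_snoc p M m' n') f f' ->
  T (C \oxl f) ∘ phi m n = phi m' n' ∘ T f'.
Proof.
rewrite /lifts => e; rewrite !last_to_frontE cmpA -flip_natural -!cmpA -!fmor_cmp.
congr (_ ∘ fmor _ _); apply: (split_mono (CMC_snocK _ _)).
by rewrite (comp_eql e) (comp_idl (CMC_unsnocK _ _)) -cmpA CMC_unsnocK cmpm1.
Qed.

Lemma front_to_last_natural m n m' n' (f : hom (CMC p M m n) (CMC p M m' n'))
    (f' : hom (CMC p M m n.+1) (CMC p M m' n'.+1)) :
  lifts (CMC_snoc p M m n) (CMC_snoc p M m' n') f f' ->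
  psi m' n' ∘ T (C \oxl f) = T f' ∘ psi m n.
Proof.
move=> e; apply: (split_epi (front_to_lastK m n)).
rewrite -!cmpA (last_to_front_natural e) (comp_idl (last_to_frontK _ _)).
by rewrite last_to_frontK cmpm1.
Qed.

End Rotation.

(** * Counits and comultiplications inside [C^n] *)
Section InteriorOperators.
Variables (X S : ncscheme) (p : ncmorphism X S).

Local Notation C := (coalg p).

Lemma counit_at0 n : counit_at p n 0 = counitT p (Cpow p n).
Proof. by case: n. Qed.

Lemma comul_at0 n : comul_at p n 0 = comulT p (Cpow p n).
Proof. by case: n. Qed.

(** The operators on [C^n] do not see a copy of [C] appended on the right. *)
Lemma lifts_counit_at n i : i <= n ->
  lifts (Cpow_snoc p n.+1) (Cpow_snoc p n) (counit_at p n i) (counit_at p n.+1 i).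
Proof.
elim: n i => [|n IH] [|i] //= le_in; try exact: lifts_counitT.
apply: lifts_ten; exact: IH.
Qed.

Lemma lifts_comul_at n i : i <= n ->
  lifts (Cpow_snoc p n.+1) (Cpow_snoc p n.+2) (comul_at p n i) (comul_at p n.+1 i).
Proof.
elim: n i => [|n IH] [|i] //= le_in; try exact: lifts_comulT.
apply: lifts_ten; exact: IH.
Qed.

Lemma counit_at_last n :
  counit_at p n n ∘ Cpow_snoc p n = run (Cpow p n) ∘ (Cpow p n \oxl counit p).
Proof.
elim: n => [|n IH].
  rewrite /= cmpE counitTE -cmpA (comp_eql (esym (run'_natural _))) !cmpA.
  by rewrite lun_unit run'K cmp1m -lun_unit lun_natural.
rewrite Cpow_snocS /ext /= cmpE cmpA tenlM IH -tenlM -!cmpA -asc_natl.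
by rewrite cmpA run_ten.
Qed.

(** The inductive step for [comul_at_last]: that [d] doubles the last factor is
    expressed through the maps [r] and [s] which append it, and this form is
    stable under adding a factor [a] on the left. *)
Lemma comul_last_ext (a k k' k'' : X) (r : hom (k \ox C) k')
    (s : hom (k' \ox C) k'') (d : hom k' k'') :
  d ∘ r = s ∘ ((r \oxm idm C) ∘ (asc' k C C ∘ (k \oxl comul p))) ->
  (a \oxl d) ∘ ext a r = ext a s ∘ ((ext a r \oxm idm C) ∘
    (asc' (a \ox k) C C ∘ ((a \ox k) \oxl comul p))).
Proof.
move=> e; rewrite /ext !cmpE [LHS]cmpA tenlM e.
rewrite -!tenrM -!tenlM -!cmpA -asc_natl (comp_eql (asc_natural _ _ _)) -!cmpA.
by rewrite pentagon_slide'.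
Qed.

Lemma comul_at_last n :
  comul_at p n n ∘ Cpow_snoc p n =
  Cpow_snoc p n.+1 ∘ ((Cpow_snoc p n \oxm idm C) ∘
    (asc' (Cpow p n) C C ∘ (Cpow p n \oxl comul p))).
Proof.
elim: n => [|n IH].
  rewrite [comul_at _ _ _]/= comulTE -cmpA /= !cmpE.
  rewrite (comp_eql (esym (run'_natural _))) -!cmpA (comp_eql (run'_ten _ _)).
  rewrite -!tenrM -!tenlM -!cmpA (comp_eql (triangleE _ _)).
  rewrite (comp_eql (tenrM _ _ _)) run'K ten1 cmp1m -lun_ten -!cmpA.
  by rewrite (comp_idl (asc'K _ _ _)) lun_natural.
exact: comul_last_ext IH.
Qed.

Lemma counit_counit_at n i j : i < j <= n.+1 ->
  counit_at p n i ∘ counit_at p n.+1 j = counit_at p n j.-1 ∘ counit_at p n.+1 i.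
Proof.
elim: n i j => [|n IH] [|i] [|j] //=.
- by case: j => // _; rewrite counitT_natural.
- move=> _; exact: (counitT_natural p (counit_at p n.+1 j)).
by case: j => [|j] ij //; rewrite !tenlM; congr (tenm _ _); apply: (IH i j.+1).
Qed.

Lemma comul_comul_at n i j : i <= j <= n ->
  comul_at p n.+1 i ∘ comul_at p n j = comul_at p n.+1 j.+1 ∘ comul_at p n i.
Proof.
elim: n i j => [|n IH] [|i] [|j] //=.
- by rewrite comulT_coassoc.
- by rewrite comulT_coassoc.
- by rewrite comulT_natural.
by move=> ij; rewrite !tenlM; congr (tenm _ _); apply: (IH i j).
Qed.

Lemma counit_comul_at_lt n i j : i < j <= n.+1 ->
  counit_at p n.+2 i ∘ comul_at p n.+1 j = comul_at p n j.-1 ∘ counit_at p n.+1 i.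
Proof.
elim: n i j => [|n IH] [|i] [|j] //=.
- by case: j => // _; rewrite counitT_natural.
- by case: j => [|j]; rewrite ?andbF.
- move=> _; exact: (counitT_natural p (comul_at p n.+1 j)).
by case: j => [|j] ij //; rewrite !tenlM; congr (tenm _ _); apply: (IH i j.+1).
Qed.

Lemma counit_comul_at_eq n i : i <= n ->
  counit_at p n.+1 i ∘ comul_at p n i = idm (Cpow p n.+1).
Proof.
elim: n i => [|n IH] [|i] //= in_; try exact: comulT_counitl.
by rewrite tenlM IH // ten1.
Qed.

Lemma counit_comul_at_eqS n i : i <= n ->
  counit_at p n.+1 i.+1 ∘ comul_at p n i = idm (Cpow p n.+1).
Proof.
elim: n i => [|n IH] [|i] //= in_; try exact: comulT_counitr.
by rewrite tenlM IH // ten1.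
Qed.

Lemma counit_comul_at_gt n i j : j.+1 < i <= n.+2 ->
  counit_at p n.+2 i ∘ comul_at p n.+1 j = comul_at p n j ∘ counit_at p n.+1 i.-1.
Proof.
elim: n i j => [|n IH] [|[|i]] [|j] //=.
- by case: i => //= _; rewrite -comulT_natural.
- by case: i => [|i]; rewrite ?andbF.
- move=> _; exact/esym/(comulT_natural p (counit_at p n.+1 i)).
by move=> ij; rewrite !tenlM; congr (tenm _ _); apply: (IH i.+1 j).
Qed.

End InteriorOperators.

(** * The operators and the boundary relations *)
Section Relations.
Variables (X S : ncscheme) (p : ncmorphism X S) (Tr : trace_functor X).
Variables (M : X) (b : braiding p M).

Local Notation C := (coalg p).
Local Notation c := (Cpow p).
Local Notation phi := (last_to_front p Tr M).
Local Notation psi := (front_to_last p Tr M).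
Local Notation T := (fmor Tr).

(** Killing the moved factor before or after moving it is the same, since the
    unit object that replaces it flips trivially. *)
Lemma last_to_front_counit n :
  T (counitT p (CMC p M 0 n)) ∘ phi 0 n = T (M \oxl counit_at p n n).
Proof.
rewrite last_to_frontE counitTE fmor_cmp -cmpA (comp_eql (esym (flip_natural _ _ _))).
rewrite -cmpA (comp_eql (flip_unit _ _)) -!fmor_cmp.
congr (fmor _ _); apply: (split_epi (CMC_unsnocK p M 0 n)).
rewrite -!cmpA CMC_snocK cmpm1 CMC_snoc0 /ext cmpE cmpA tenlM counit_at_last.
by rewrite -tenlM -cmpA -asc_natl cmpA run_ten.
Qed.

(** Moving a factor and then doubling it amounts to doubling it and moving both
    copies in turn, the flip past [C (x) C] being two flips. *)
Lemma last_to_front_comul n :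
  T (comulT p (CMC p M 0 n)) ∘ phi 0 n =
  phi 1 n ∘ (phi 0 n.+1 ∘ T (M \oxl comul_at p n n)).
Proof.
rewrite !last_to_frontE comulTE fmor_cmp -!cmpA (comp_eql (esym (flip_natural _ _ _))).
rewrite flip_past_pair -!cmpA (comp_idl (fmor_asc'K _ _ _ _)).
rewrite [CMC_unsnoc p M 1 n]cmpE fmor_cmp -!cmpA.
rewrite (comp_eql (esym (flip_natural _ _ _))) -!cmpA -!fmor_cmp.
do 3!congr (_ ∘ _); congr (fmor _ _).
have K : (CMC_unsnoc p M 0 n \oxm idm C) ∘ (CMC_snoc p M 0 n \oxm idm C) = idm _.
  by rewrite tenrM CMC_snocK ten1.
have K' : (CMC_snoc p M 0 n \oxm idm C) ∘ (CMC_unsnoc p M 0 n \oxm idm C) = idm _.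
  by rewrite tenrM CMC_unsnocK ten1.
apply: (split_mono K); rewrite (comp_idl K').
apply: (split_mono (CMC_snocK p M 0 n.+1)); rewrite (comp_idl (CMC_unsnocK _ _ _ _)).
apply: (split_epi (CMC_unsnocK p M 0 n)); rewrite -!cmpA CMC_snocK cmpm1.
by rewrite CMC_snoc0 (comul_last_ext M (comul_at_last p n)).
Qed.

(** The last degeneracy before its flip:
    [(m, c) |-> c'_(1) (x) beta (c'_(2), m')] with [beta^-1 (m, c) = c' (x) m']. *)
Definition splitT (U : X) : hom (M \ox C \ox U) (C \ox M \ox C \ox U) :=
  (C \oxl braidT b U) \o (comulT p (M \ox U) \o braidT' b U).

Lemma splitTE U :
  splitT U = (C \oxl braidT b U) ∘ (comulT p (M \ox U) ∘ braidT' b U).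
Proof. by rewrite /splitT !cmpE. Qed.

Lemma splitT_natural (U V : X) (f : hom U V) :
  splitT V ∘ (M \oxl C \oxl f) = (C \oxl M \oxl C \oxl f) ∘ splitT U.
Proof.
rewrite !splitTE -!cmpA braidT'_natural (comp_eql (comulT_natural _ _)) -!cmpA.
by rewrite !(comp_eql (tenlM _ _ _)) braidT_natural.
Qed.

Lemma lifts_splitT (U V W : X) (r : hom (V \ox U) W) :
  lifts (ext M (ext C r)) (ext C (ext M (ext C r))) (splitT V) (splitT W).
Proof.
rewrite !splitTE; apply: lifts_comp (lifts_ten _ (lifts_braidT _ _)) _.
exact: lifts_comp (lifts_comulT _ _) (lifts_braidT' _ _).
Qed.

(** The operators, typed by the words that the flips act on. *)
Definition face_op n i : hom (Tr (CMC p M 0 n.+1)) (Tr (CMC p M 0 n)) :=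
  tr_face Tr b n i.
Definition degen_op n (n_gt0 : 0 < n) i :
  hom (Tr (CMC p M 0 n)) (Tr (CMC p M 0 n.+1)) := tr_degen Tr b n_gt0 i.
Definition cyc_op n : hom (Tr (CMC p M 0 n)) (Tr (CMC p M 0 n)) := tr_cyc Tr b n.

Lemma faceE n i : i <= n -> face_op n i = T (M \oxl counit_at p n i).
Proof. by rewrite /face_op /tr_face => ->. Qed.

Lemma face_lastE n : face_op n n.+1 =
  T (M \oxl counitT p (c n)) ∘ (T (braidT b (c n)) ∘ phi 0 n).
Proof. by rewrite /face_op /tr_face ltnn !cmpE fmor_cmp -cmpA. Qed.

Lemma cycE n : cyc_op n.+1 = T (braidT b (c n)) ∘ phi 0 n.
Proof. exact: cmpE. Qed.

Lemma degenE n (n_gt0 : 0 < n.+1) i : i <= n ->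
  degen_op n_gt0 i = T (M \oxl comul_at p n i).
Proof. by rewrite /degen_op /tr_degen => ->. Qed.

Lemma degen_lastE n (n_gt0 : 0 < n.+1) :
  degen_op n_gt0 n.+1 = psi 0 n.+1 ∘ T (splitT (c n)).
Proof.
rewrite /degen_op /tr_degen ltnn cmpE splitTE.
by rewrite [in LHS]cmpE [in LHS]cmpE -cmpA.
Qed.

Lemma face0_cyc_op n :
  face_op n 0 ∘ cyc_op n.+1 = face_op n n.+1.
Proof. by rewrite faceE // cycE face_lastE counit_at0. Qed.

(** rotations of operators away from the moved factor *)
(** The face acts on a factor that the rotation does not move, so the claim is
    naturality of the flip and of the braiding. *)
Lemma face_cyc_interior n i : 0 < i <= n ->
  face_op n i ∘ cyc_op n.+1 = cyc_op n ∘ face_op n i.-1.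
Proof.
case: n i => [|n] [|i] // le_in; rewrite !faceE ?(ltnW le_in) // !cycE.
rewrite cmpA -!fmor_cmp -braidT_natural fmor_cmp -!cmpA; congr (_ ∘ _).
apply: (@last_to_front_natural _ _ p Tr M 0 n.+1 0 n (M \oxl counit_at p n i)).
exact/lifts_ten/lifts_counit_at.
Qed.

Lemma last_to_front_braid n :
  phi 0 n.+1 ∘ T (braidT b (c n.+1)) = T (C \oxl braidT b (c n)) ∘ phi 1 n.
Proof.
apply: esym; apply: (@last_to_front_natural _ _ p Tr M 1 n 0 n.+1 (braidT b (c n))).
exact: lifts_braidT.
Qed.

Lemma last_to_front_counitT n :
  phi 0 n ∘ T (counitT p (CMC p M 0 n.+1)) =
  T (C \oxl counitT p (CMC p M 0 n)) ∘ phi 1 n.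
Proof.
apply: esym; apply: (@last_to_front_natural _ _ p Tr M 1 n 0 n (counitT p (M \ox c n))).
exact: lifts_counitT.
Qed.

Lemma last_to_front_splitT n :
  phi 1 n.+1 ∘ T (splitT (c n.+1)) = T (C \oxl splitT (c n)) ∘ phi 0 n.+1.
Proof.
apply: esym; apply: (@last_to_front_natural _ _ p Tr M 0 n.+1 1 n.+1 (splitT (c n))).
exact: lifts_splitT.
Qed.

(** With [face_cyc_last_rhs]: both sides of the last rotation relation for faces
    are traces of the two sides of VI, after the same two flips. *)
Lemma face_cyc_last_lhs n :
  face_op n.+1 n.+2 ∘ cyc_op n.+2 =
  T ((M \oxl counitT p (C \ox c n)) ∘ braidT b (C \ox c n) ∘
     (C \oxl braidT b (c n))) ∘ (phi 1 n ∘ phi 0 n.+1).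
Proof.
rewrite face_lastE cycE -!cmpA (comp_eql (last_to_front_braid n)) -!cmpA.
by rewrite !fmor_cmp -!cmpA.
Qed.

Lemma face_cyc_last_rhs n :
  cyc_op n.+1 ∘ face_op n.+1 n.+1 =
  T (braidT b (c n) ∘ (C \oxl counitT p (M \ox c n))) ∘ (phi 1 n ∘ phi 0 n.+1).
Proof.
rewrite faceE // cycE -last_to_front_counit -!cmpA (comp_eql (last_to_front_counitT n)).
by rewrite !fmor_cmp -!cmpA.
Qed.

(** The face kills the copy [c'_(1)] that the degeneracy has just moved to the
    end, which leaves [beta (beta^-1 (m, c))]. *)
Lemma face_degen_last n (n_gt0 : 0 < n.+1) :
  face_op n.+1 n.+1 ∘ degen_op n_gt0 n.+1 = idm (Tr (M \ox c n.+1)).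
Proof.
rewrite faceE // degen_lastE -last_to_front_counit -!cmpA.
rewrite (comp_idl (front_to_lastK p Tr M 0 n.+1)).
rewrite -fmor_cmp splitTE (comp_eql (counitT_natural _ _)) -!cmpA.
by rewrite (comp_idl (comulT_counitl _ _)) braidT'K fmor1.
Qed.

(** The flip of the degeneracy cancels the flip of the last face, and what is
    left is the right-hand side of IV, composed with [beta^-1]. *)
Lemma face_degen_lastS n (n_gt0 : 0 < n.+1) :
  face_op n.+1 n.+2 ∘ degen_op n_gt0 n.+1 =
  T ((M \oxl counitT p (C \ox c n)) ∘ braidT b (C \ox c n) ∘
     (C \oxl braidT b (c n)) ∘ comulT p (M \ox c n)) ∘ T (braidT' b (c n)).
Proof.
rewrite face_lastE degen_lastE -!cmpA (comp_idl (front_to_lastK p Tr M 0 n.+1)).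
by rewrite splitTE !fmor_cmp -!cmpA.
Qed.

(** With [face_degen_last_rhs]: for [i = 0] the two traces are those of III, and
    for [i > 0] they agree by naturality of [splitT]. *)
Lemma face_degen_last_lhs n (n_gt0 : 0 < n.+2) i : i <= n.+1 ->
  face_op n.+2 i ∘ degen_op n_gt0 n.+2 =
  psi 0 n.+1 ∘ T ((C \oxl M \oxl counit_at p n.+1 i) ∘ splitT (c n.+1)).
Proof.
move=> le_in; rewrite faceE ?(leq_trans le_in) // degen_lastE fmor_cmp !cmpA.
congr (_ ∘ _); apply: esym.
apply: (@front_to_last_natural _ _ p Tr M 0 n.+2 0 n.+1 (M \oxl counit_at p n.+1 i)).
exact/lifts_ten/lifts_counit_at.
Qed.

Lemma face_degen_last_rhs n (n_gt0 : 0 < n.+1) i : i <= n.+1 ->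
  degen_op n_gt0 n.+1 ∘ face_op n.+1 i =
  psi 0 n.+1 ∘ T (splitT (c n) ∘ (M \oxl counit_at p n.+1 i)).
Proof. by move=> le_in; rewrite faceE // degen_lastE fmor_cmp -!cmpA. Qed.

Lemma degen_cyc_interior n (n_gt0 : 0 < n.+1) i : 0 < i <= n ->
  degen_op n_gt0 i ∘ cyc_op n.+1 =
  cyc_op n.+2 ∘ degen_op n_gt0 i.-1.
Proof.
case: n n_gt0 i => [|n] n_gt0 [|i] // le_in.
rewrite !degenE ?(ltnW le_in) // !cycE.
rewrite cmpA -!fmor_cmp -braidT_natural fmor_cmp -!cmpA; congr (_ ∘ _).
apply: (@last_to_front_natural _ _ p Tr M 0 n.+1 0 n.+2 (M \oxl comul_at p n i)).
exact/lifts_ten/lifts_comul_at.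
Qed.

(** On both sides the last factor is doubled, one copy is braided past [M] and
    the other stays last. *)
Lemma degen_cyc_last n (n_gt0 : 0 < n.+1) :
  degen_op n_gt0 n.+1 ∘ cyc_op n.+1 =
  cyc_op n.+2 ∘ degen_op n_gt0 n.
Proof.
rewrite degen_lastE degenE // !cycE; apply: (split_mono (last_to_frontK p Tr M 0 n.+1)).
rewrite -!cmpA (comp_idl (front_to_lastK p Tr M 0 n.+1)).
rewrite (comp_eql (last_to_front_braid n)) -!cmpA.
rewrite -last_to_front_comul splitTE !cmpA -!fmor_cmp -!cmpA braidTK cmpm1 //.
Qed.

(** With [degen0_cyc_rhs]: both sides are traces after one flip, of the two sides
    of I composed with [beta^-1]. *)
Lemma degen0_cyc_lhs n (n_gt0 : 0 < n.+2) :
  degen_op n_gt0 0 ∘ cyc_op n.+2 =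
  T ((M \oxl comulT p (C \ox c n)) ∘ braidT b (C \ox c n)) ∘ phi 0 n.+1.
Proof. by rewrite degenE // cycE comul_at0 fmor_cmp -cmpA. Qed.

Lemma degen0_cyc_rhs n (n_gt0 : 0 < n.+2) :
  cyc_op n.+3 ∘ (cyc_op n.+3 ∘ degen_op n_gt0 n.+2) =
  T (braidT b (C \ox C \ox c n) ∘ (C \oxl braidT b (C \ox c n)) ∘
    (C \oxl C \oxl braidT b (c n)) ∘ (C \oxl comulT p (M \ox c n)) ∘
    (C \oxl braidT' b (c n))) ∘ phi 0 n.+1.
Proof.
rewrite degen_lastE !cycE -!cmpA (comp_idl (front_to_lastK p Tr M 0 n.+2)).
rewrite (comp_eql (last_to_front_braid n.+1)) -!cmpA last_to_front_splitT splitTE -!tenlM.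
by rewrite !fmor_cmp -!cmpA.
Qed.

(** With [degen_degen_last_rhs]: for [i = 0] the two traces are those of II, and
    for [i > 0] they agree by naturality of [splitT]. *)
Lemma degen_degen_last_lhs n (n_gt0 : 0 < n.+1) (n1_gt0 : 0 < n.+2) i : i <= n ->
  degen_op n1_gt0 i ∘ degen_op n_gt0 n.+1 =
  psi 0 n.+2 ∘ T ((C \oxl M \oxl comul_at p n i) ∘ splitT (c n)).
Proof.
move=> le_in; rewrite degenE ?(leq_trans le_in) // degen_lastE fmor_cmp !cmpA.
congr (_ ∘ _); apply: esym.
apply: (@front_to_last_natural _ _ p Tr M 0 n.+1 0 n.+2 (M \oxl comul_at p n i)).
exact/lifts_ten/lifts_comul_at.
Qed.

Lemma degen_degen_last_rhs n (n_gt0 : 0 < n.+1) (n1_gt0 : 0 < n.+2) i : i <= n ->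
  degen_op n1_gt0 n.+2 ∘ degen_op n_gt0 i =
  psi 0 n.+2 ∘ T (splitT (c n.+1) ∘ (M \oxl comul_at p n i)).
Proof.
by move=> le_in; rewrite (degenE n_gt0 le_in) degen_lastE fmor_cmp -!cmpA.
Qed.

(** Splitting twice undoes the inner braiding, so that only coassociativity is
    left. *)
Lemma splitT_coassoc U :
  comulT p (M \ox C \ox U) ∘ splitT U = (C \oxl splitT U) ∘ splitT U.
Proof.
rewrite splitTE (comp_eql (comulT_natural _ _)) -!cmpA.
rewrite (comp_eql (esym (comulT_coassoc _ _))) -!tenlM -!cmpA.
have K : (C \oxl braidT' b U) ∘ (C \oxl braidT b U) = idm _.
  by rewrite tenlM braidTK ten1.
by rewrite (comp_idl K).
Qed.

Lemma degen_degen_last n (n_gt0 : 0 < n.+1) (n1_gt0 : 0 < n.+2) :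
  degen_op n1_gt0 n.+1 ∘ degen_op n_gt0 n.+1 =
  degen_op n1_gt0 n.+2 ∘ degen_op n_gt0 n.+1.
Proof.
rewrite (degenE n1_gt0 (leqnn n.+1)) (degen_lastE n_gt0) (degen_lastE n1_gt0).
apply: (split_mono (last_to_frontK p Tr M 0 n.+2)).
apply: (split_mono (last_to_frontK p Tr M 1 n.+1)).
rewrite -!cmpA (comp_idl (front_to_lastK p Tr M 0 n.+2)).
rewrite (comp_eql (last_to_front_splitT n)) -!cmpA.
have e : T (comulT p (CMC p M 0 n.+1)) = phi 1 n.+1 ∘ (phi 0 n.+2 ∘
    (T (M \oxl comul_at p n.+1 n.+1) ∘ psi 0 n.+1)).
  rewrite -[LHS]cmpm1 -(front_to_lastK p Tr M 0 n.+1) (comp_eql (last_to_front_comul n.+1)).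
  by rewrite -!cmpA.
rewrite (comp_idl (front_to_lastK p Tr M 0 n.+1)) -!fmor_cmp -splitT_coassoc fmor_cmp e.
by rewrite -!cmpA.
Qed.

End Relations.

(** * The period of the rotation *)
Section Powers.
Variables (X S : ncscheme) (p : ncmorphism X S).

Local Notation C := (coalg p).
Local Notation c := (Cpow p).

(** Transport along the identities [j + k.+1 = (j + k).+1] and the like, which do
    not hold by computation. *)
Definition recast m n (e : m = n) : hom (c m) (c n) :=
  match e with erefl => idm (c m) end.

Lemma recast1 n (e : n = n) : recast e = idm (c n).
Proof. by rewrite (eq_irrelevance e (erefl n)). Qed.

Lemma recast_comp m n k (e : m = n) (e' : n = k) (e'' : m = k) :
  recast e' ∘ recast e = recast e''.
Proof. by case: k / e' e'' => e''; rewrite recast1 cmp1m (eq_irrelevance e'' e). Qed.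

Lemma recastS m n (e : m = n) (e' : m.+1 = n.+1) :
  recast e' = C \oxl recast e.
Proof. by case: n / e e' => e'; rewrite recast1 ten1. Qed.

Fixpoint Cpow_cat k j : hom (c k \ox c j) (c (k + j)) :=
  match k with
  | 0 => lun (c j)
  | k'.+1 => ext C (Cpow_cat k' j)
  end.

Lemma Cpow_cat0 k (e : k + 0 = k) : recast e ∘ Cpow_cat k 0 = run (c k).
Proof.
elim: k e => [|k IH] e; first by rewrite recast1 cmp1m /= lun_unit.
rewrite (recastS (addn0 k)) [Cpow_cat _ _]/= /ext cmpE cmpA tenlM IH.
exact: run_ten.
Qed.

(** Transferring a last factor from one block to the next is compatible with
    adding a factor on the left. *)
Lemma ext_fuse (a k k' j z : X) (r : hom (k \ox C) k') (u : hom (k' \ox j) z)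
    (v : hom (k \ox C \ox j) z) :
  u ∘ (r \oxm idm j) = v ∘ asc k C j ->
  ext a u ∘ (ext a r \oxm idm j) = ext a v ∘ asc (a \ox k) C j.
Proof.
move=> e; rewrite /ext !cmpE -tenrM -!cmpA (comp_eql (asc_natural _ _ _)) -!cmpA.
by rewrite (comp_eql (tenlM _ _ _)) e -tenlM -!cmpA -pentagonE.
Qed.

Lemma Cpow_cat_snoc k j (e : k + j.+1 = k.+1 + j) :
  Cpow_cat k.+1 j ∘ (Cpow_snoc p k \oxm idm (c j)) =
  (recast e ∘ Cpow_cat k j.+1) ∘ asc (c k) C (c j).
Proof.
elim: k e => [|k IH] e.
  rewrite recast1 cmp1m /= /ext !cmpE lun_ten -tenrM -!cmpA.
  rewrite (comp_eql (triangleE _ _)) (comp_eql (tenrM _ _ _)) run'K.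
  by rewrite ten1 cmp1m.
have e' : k + j.+1 = k.+1 + j by rewrite addnS.
rewrite (recastS e') Cpow_snocS -[Cpow_cat k.+2 j]/(ext C (Cpow_cat k.+1 j)).
by rewrite (ext_fuse C (IH e')) /= /ext !cmpE -!cmpA (comp_eql (tenlM _ _ _)).
Qed.

Fixpoint Cten_assoc j (W V : X) :
    hom (Cten p j W \ox V) (Cten p j (W \ox V)) :=
  match j with
  | 0 => idm (W \ox V)
  | j'.+1 => ext C (Cten_assoc j' W V)
  end.

Lemma Cten_split_natural j (W V : X) (f : hom W V) :
  Cten_split p j V ∘ Cten_mor p j f = (c j \oxl f) ∘ Cten_split p j W.
Proof.
elim: j => [|j IH]; first exact: lun'_natural.
rewrite /= !cmpE -!cmpA tenlM IH -tenlM !cmpA; congr (_ ∘ _).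
by rewrite asc'_natl.
Qed.

Lemma Cten_split_assoc j (W V : X) :
  asc (c j) W V ∘ (Cten_split p j W \oxm idm V) =
  Cten_split p j (W \ox V) ∘ Cten_assoc j W V.
Proof.
elim: j => [|j IH].
  rewrite /= cmpm1; apply: (split_mono (lunK _)).
  by rewrite cmpA lun_ten tenrM !lun'K ten1.
rewrite /= /ext !cmpE -tenrM -!cmpA (comp_eql (tenlM _ _ _)) -IH -tenlM -!cmpA.
by rewrite -asc_natural (comp_eql (esym (pentagon_slide _ _ _ _))) -!cmpA.
Qed.

Variable Tr : trace_functor X.
Local Notation T := (fmor Tr).

(** Flipping [C^j] to the back in one go. *)
Definition gather j (W : X) : hom (Tr (Cten p j W)) (Tr (W \ox c j)) :=
  flip Tr (c j) W \o T (Cten_split p j W).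

Lemma gatherE j W : gather j W = flip Tr (c j) W ∘ T (Cten_split p j W).
Proof. exact: cmpE. Qed.

Lemma gather_natural j (W V : X) (f : hom W V) :
  gather j V ∘ T (Cten_mor p j f) = T (f \oxm idm (c j)) ∘ gather j W.
Proof.
rewrite !gatherE -cmpA -fmor_cmp Cten_split_natural fmor_cmp.
by rewrite (comp_eql (flip_natural _ _ _)) -cmpA.
Qed.

Lemma flip_unitl (W : X) : flip Tr (OO X) W ∘ T (lun' W) = T (run' W).
Proof.
have K : T (lun' W) ∘ T (lun W) = idm _ by rewrite -fmor_cmp lunK fmor1.
apply: (split_mono (flip_flip Tr W (OO X))); apply: (split_mono K).
rewrite (comp_idl (flip_flip _ _ _)) (comp_eql (flip_unit _ _)).
by rewrite -!fmor_cmp lun'K run'K.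
Qed.

Lemma gather0 W : gather 0 W = T (run' W).
Proof. by rewrite gatherE /= flip_unitl. Qed.

Lemma flip_pair_past (a b d : X) :
  flip Tr (b \ox d) a =
    T (asc a b d) ∘ (flip Tr d (a \ox b) ∘
      (T (asc d a b) ∘ (flip Tr b (d \ox a) ∘ T (asc b d a)))).
Proof.
apply: (split_mono (flip_flip Tr a (b \ox d))).
rewrite flip_flip flip_past_pair -!cmpA.
rewrite (comp_idl (fmor_ascK _ _ _ _)) (comp_idl (flip_flip _ _ _)).
rewrite (comp_idl (fmor_ascK _ _ _ _)) (comp_idl (flip_flip _ _ _)).
by rewrite fmor_ascK.
Qed.

(** Flipping [C (x) C^j] past [W] is flipping [C] past [C^j (x) W] and then [C^j]
    past [W (x) C]. *)
Lemma gatherS j W :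
  gather j.+1 W = T (asc W C (c j)) ∘ (gather j (W \ox C) ∘
    (T (Cten_assoc j W C) ∘ flip Tr C (Cten p j W))).
Proof.
rewrite !gatherE /= cmpE flip_pair_past fmor_cmp -!cmpA.
rewrite (comp_idl (fmor_asc'K _ _ _ _)) flip_natural.
have e : T (asc (c j) W C) ∘ T (Cten_split p j W \oxm idm C) =
    T (Cten_split p j (W \ox C)) ∘ T (Cten_assoc j W C).
  by rewrite -!fmor_cmp Cten_split_assoc.
by rewrite (comp_eql e) -!cmpA.
Qed.

Section Iterated.
Variable M : X.

Local Notation phi := (last_to_front p Tr M).

Definition join k j : hom (CMC p M 0 k \ox c j) (CMC p M 0 (k + j)) :=
  ext M (Cpow_cat k j).

Definition recastM m n (e : m = n) : hom (CMC p M 0 m) (CMC p M 0 n) :=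
  M \oxl recast e.

Lemma recastM1 n (e : n = n) : recastM e = idm (CMC p M 0 n).
Proof. by rewrite /recastM recast1 ten1. Qed.

Lemma recastM_comp m n k (e : m = n) (e' : n = k) (e'' : m = k) :
  recastM e' ∘ recastM e = recastM e''.
Proof. by rewrite /recastM tenlM (recast_comp _ _ e''). Qed.

Lemma CMC_snoc_split j k :
  CMC_snoc p M j k =
  Cten_mor p j (CMC_snoc p M 0 k) ∘ Cten_assoc j (CMC p M 0 k) C.
Proof.
elim: j => [|j IH]; first by rewrite cmpm1.
by rewrite CMC_snocS IH /= /ext !cmpE cmpA tenlM.
Qed.

Lemma Cten_mor_comp j (U V W : X) (g : hom V W) (f : hom U V) :
  Cten_mor p j g ∘ Cten_mor p j f = Cten_mor p j (g ∘ f).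
Proof. by elim: j => [|j IH] //=; rewrite tenlM IH. Qed.

Lemma Cten_mor1 j (U : X) : Cten_mor p j (idm U) = idm (Cten p j U).
Proof. by elim: j => [|j IH] //=; rewrite IH ten1. Qed.

Lemma gatherS_last_to_front j k :
  gather j.+1 (CMC p M 0 k) ∘ phi j k =
  T (asc (CMC p M 0 k) C (c j) ∘ (CMC_unsnoc p M 0 k \oxm idm (c j))) ∘
    gather j (CMC p M 0 k.+1).
Proof.
rewrite gatherS last_to_frontE -!cmpA (comp_idl (flip_flip _ _ _)) -fmor_cmp.
have -> : Cten_assoc j (CMC p M 0 k) C ∘ CMC_unsnoc p M j k =
    Cten_mor p j (CMC_unsnoc p M 0 k).
  apply: (split_epi (CMC_unsnocK p M j k)); rewrite -cmpA CMC_snocK cmpm1.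
  by rewrite CMC_snoc_split cmpA Cten_mor_comp CMC_snocK Cten_mor1 cmp1m.
by rewrite gather_natural fmor_cmp -!cmpA.
Qed.

Lemma join_snoc k j (e : k + j.+1 = k.+1 + j) :
  (recastM e ∘ join k j.+1) ∘ asc (CMC p M 0 k) C (c j) =
  join k.+1 j ∘ (CMC_snoc p M 0 k \oxm idm (c j)).
Proof.
rewrite /join CMC_snoc0 (ext_fuse M (Cpow_cat_snoc e)) /recastM /ext !cmpE.
by rewrite [in LHS]cmpA tenlM.
Qed.

Lemma join0 k (e : k + 0 = k) :
  recastM e ∘ join k 0 = run (CMC p M 0 k).
Proof. by rewrite /recastM /join /ext cmpE cmpA tenlM Cpow_cat0 run_ten. Qed.

(** Undoing a flip of one copy to the front leaves one copy fewer to gather. *)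
Lemma join_gather_last_to_front j k n (e : k + j.+1 = n) (e' : k.+1 + j = n) :
  T (recastM e ∘ join k j.+1) ∘ (gather j.+1 (CMC p M 0 k) ∘ phi j k) =
  T (recastM e' ∘ join k.+1 j) ∘ gather j (CMC p M 0 k.+1).
Proof.
rewrite gatherS_last_to_front cmpA -fmor_cmp; congr (fmor _ _ ∘ _).
have e0 : k + j.+1 = k.+1 + j by rewrite addnS.
rewrite -(recastM_comp e0 e' e) -!cmpA.
rewrite [recastM e0 ∘ _]cmpA (comp_eql (join_snoc e0)) -cmpA.
by rewrite tenrM CMC_unsnocK ten1 cmpm1.
Qed.

Section Braiding.
Variable b : braiding p M.

Local Notation cyc_op := (cyc_op Tr b).

(** [C^j (x) M (x) C^k -> M (x) C^(j+k)], braiding the copies of [C] past [M] from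
    the innermost to the outermost. *)
Fixpoint braid_all j k : hom (CMC p M j k) (CMC p M 0 (j + k)) :=
  match j with
  | 0 => idm (CMC p M 0 k)
  | j'.+1 => braidT b (c (j' + k)) \o (C \oxl braid_all j' k)
  end.

Lemma braid_allS j k :
  braid_all j.+1 k = braidT b (c (j + k)) ∘ (C \oxl braid_all j k).
Proof. exact: cmpE. Qed.

Lemma lifts_braid_all j k (e : j + k.+1 = (j + k).+1) :
  lifts (CMC_snoc p M j k) (CMC_snoc p M 0 (j + k))
    (braid_all j k) (recastM e ∘ braid_all j k.+1).
Proof.
elim: j e => [|j IH] e; first by rewrite recastM1 cmpm1; apply: lifts1.
have e' : j + k.+1 = (j + k).+1 by rewrite addnS.
rewrite !braid_allS cmpA /recastM (recastS e') -braidT_natural -cmpA tenlM.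
apply: lifts_comp (lifts_ten C (IH e')); exact: lifts_braidT.
Qed.

(** A rotation moves the last copy, which [braid_all] has not touched; so the
    flip may be done before the braidings. *)
Lemma cyc_op_braid_all j k (e : j + k.+1 = (j + k).+1) :
  cyc_op (j + k).+1 ∘ T (recastM e ∘ braid_all j k.+1) =
  T (braid_all j.+1 k) ∘ phi j k.
Proof.
rewrite cycE -cmpA -(last_to_front_natural Tr (lifts_braid_all e)) cmpA -fmor_cmp.
by rewrite braid_allS.
Qed.

Lemma cyc_op_recast m n (e : m = n) :
  cyc_op n ∘ T (recastM e) = T (recastM e) ∘ cyc_op m.
Proof. by case: n / e; rewrite recastM1 fmor1 cmp1m cmpm1. Qed.

(** After [j] rotations the last [j] copies of [C] have been flipped to the front
    (by [x]) and then braided back.  As [x] consists of flips alone, flipping all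
    of them back at once inverts it. *)
Lemma iterated_rotation j k n (e : j + k = n) (e' : k + j = n) :
  exists x : hom (Tr (CMC p M 0 n)) (Tr (CMC p M j k)),
    T (recastM e ∘ braid_all j k) ∘ x =
      iter j (fun f => cyc_op n ∘ f) (idm (Tr (CMC p M 0 n))) /\
    T (recastM e' ∘ join k j) ∘ (gather j (CMC p M 0 k) ∘ x) = idm _.
Proof.
elim: j k e e' => [|j IH] k e e'.
  case: n / e e' => e'; exists (idm _); split.
    by rewrite recastM1 !cmpm1 fmor1.
  by rewrite join0 cmpm1 gather0 -fmor_cmp run'K fmor1.
have e1 : j + k.+1 = n by rewrite addnS.
have e1' : k.+1 + j = n by rewrite addSn -addnS.
have [x [x1 x2]] := IH k.+1 e1 e1';
(* [x] moves [j] copies, and one more flip moves the next. *)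
exists (phi j k ∘ x); split; last first.
  rewrite [gather _ _ ∘ _]cmpA [LHS]cmpA (join_gather_last_to_front e' e1') -cmpA.
  exact: x2.
rewrite iterS -x1 {IH}.
case: n / e e' e1 e1' x x1 x2 => e' e1 e1' x x1 x2.
by rewrite recastM1 cmp1m !cmpA -cyc_op_braid_all.
Qed.

Lemma braid_all_right j k (e : j + k.+1 = (j + k).+1) :
  braid_all j.+1 k = recastM e ∘ (braid_all j k.+1 ∘ braid_right b j k).
Proof.
elim: j e => [|j IH] e.
  by rewrite braid_allS ten1 cmpm1 recastM1 !cmp1m.
have e' : j + k.+1 = (j + k).+1 by rewrite addnS.
rewrite braid_allS (IH e') -!tenlM /recastM (recastS e') [braid_all j.+1 _]braid_allS.
by rewrite -!cmpA [RHS]cmpA -braidT_natural -!cmpA.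
Qed.

Lemma braid_all_unbraid n (e : n + 0 = n) :
  recastM e ∘ (braid_all n 0 ∘ unbraid_all b n) = idm (CMC p M 0 n).
Proof.
elim: n e => [|n IH] e; first by rewrite recastM1 !cmp1m.
have e' := addn0 n.
rewrite braid_allS /= cmpE -!cmpA /recastM (recastS e').
rewrite (comp_eql (esym (braidT_natural _ _))) -cmpA.
rewrite !(comp_eql (tenlM _ _ _)) -cmpA IH ten1 cmp1m.
exact: braidT'K.
Qed.

Lemma powers_to_backE n (e : 0 + n = n) :
  powers_to_back p Tr M n =
  T (recastM e ∘ join 0 n) ∘ gather n (CMC p M 0 0).
Proof.
rewrite /powers_to_back !cmpE gatherE recastM1 cmp1m /join /= /ext cmpE.
by rewrite triangleE.
Qed.

(** By the second square, braiding all of [C^(n+1)] back and rotating once more is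
    the flip of all of [C^(n+1)] to the back; and that is inverse to the flips
    that make up the first [n + 1] rotations. *)
Lemma cyc_op_period n : trace_compatible Tr b ->
  iter n.+2 (fun f => cyc_op n.+1 ∘ f) (idm _) = idm (Tr (CMC p M 0 n.+1)).
Proof.
case=> _ square2.
have [x [x1 x2]] := @iterated_rotation n.+1 0 n.+1 (addn0 _) (add0n _).
rewrite cmpA -powers_to_backE in x2.
have e0 : n + 1 = (n + 0).+1 by rewrite addnS.
rewrite iterS -x1 -x2 cmpA; congr (cmp _ x).
rewrite fmor_cmp cmpA cyc_op_recast -cmpA (braid_all_right e0) cmpA fmor_cmp cmpA.
have rb : cyc_op (n.+1 + 0) ∘ T (recastM e0 ∘ braid_all n 1) =
  T (braid_all n.+1 0) ∘ phi n 0 := cyc_op_braid_all e0.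
rewrite fmor_cmp in rb; rewrite -!cmpA fmor_cmp [T (recastM e0) ∘ _]cmpA.
rewrite (comp_eql rb) -!cmpA.
have /esym := square2 n; rewrite !cmpE => ->.
rewrite !cmpA -!fmor_cmp -cmpA braid_all_unbraid fmor1 cmp1m //.
Qed.

End Braiding.
End Iterated.
End Powers.

(** * From the axioms to the relations and back *)
Section Equivalence.
Variables (X S : ncscheme) (p : ncmorphism X S) (Tr : trace_functor X).
Variables (M : X) (b : braiding p M).

Local Notation C := (coalg p).
Local Notation c := (Cpow p).
Local Notation phi := (last_to_front p Tr M).
Local Notation psi := (front_to_last p Tr M).
Local Notation T := (fmor Tr).
Local Notation beta := (iso_fwd b).
Local Notation beta' := (iso_bwd b).
Local Notation face_op := (face_op Tr b).
Local Notation degen_op := (degen_op Tr b).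
Local Notation cyc_op := (cyc_op Tr b).

Lemma tail_II_splitT U : tail_form U
  ((C \oxl braidT b C) ∘ comulT p (M \ox C) ∘ braidT' b C ∘ (M \oxl comul p))
  ((C \oxl M \oxl comul p) ∘ (C \oxl beta) ∘ comulT p M ∘ beta')
  (splitT b (C \ox U) ∘ (M \oxl comulT p U))
  ((C \oxl M \oxl comulT p U) ∘ splitT b U).
Proof. by have := tail_II b U; rewrite !splitTE -!cmpA. Qed.

(** Both sides of III, stripped of the isomorphisms [C (x) beta^-1] on the left
    and [beta] on the right, are [splitT] composed with a counit. *)
Lemma tail_III_splitT U : tail_form U
  ((C \oxl beta') ∘ (C \oxl M \oxl counitT p C) ∘ (C \oxl braidT b C) ∘
      comulT p (M \ox C))
  (comulT p M ∘ beta' ∘ (M \oxl counitT p C) ∘ braidT b C)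
  ((C \oxl braidT' b U) ∘
    ((C \oxl M \oxl counitT p (C \ox U)) ∘ splitT b (C \ox U)) ∘
    braidT b (C \ox U))
  ((C \oxl braidT' b U) ∘ (splitT b U ∘ (M \oxl counitT p (C \ox U))) ∘
    braidT b (C \ox U)).
Proof.
have := tail_III b U; rewrite !splitTE -!cmpA braidTK cmpm1.
have K : (C \oxl braidT' b U) ∘ (C \oxl braidT b U) = idm _.
  by rewrite tenlM braidTK ten1.
by rewrite (comp_idl K).
Qed.

Section FromCoefficients.
Hypotheses (coeff : coefficients b) (compat : trace_compatible Tr b).

Lemma cyc_op_iter n :
  iter n.+1 (fun f => cyc_op n ∘ f) (idm _) = idm (Tr (CMC p M 0 n)).
Proof.
case: n => [|n]; last exact: cyc_op_period.
by rewrite /= cmpm1.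
Qed.

Lemma cyc_op1_twice : cyc_op 1 ∘ cyc_op 1 = idm _.
Proof. by have := cyc_op_iter 1; rewrite !iterS cmpm1. Qed.

Lemma cyc_op2_thrice : cyc_op 2 ∘ (cyc_op 2 ∘ cyc_op 2) = idm _.
Proof. by have := cyc_op_iter 2; rewrite !iterS cmpm1. Qed.

(** VI gives the last case in positive degrees.  In degree 0 there is no factor
    for VI to act on, and [t_1^2 = 1] is used instead. *)
Lemma face_cyc_op n i : 0 < i <= n.+1 ->
  face_op n i ∘ cyc_op n.+1 = cyc_op n ∘ face_op n i.-1.
Proof.
case/andP=> i_gt0; rewrite leq_eqVlt => /orP[/eqP->|le_in]; last first.
  by rewrite face_cyc_interior // i_gt0.
case: n => [|n]; last first.
  rewrite face_cyc_last_lhs face_cyc_last_rhs; congr (T _ ∘ _).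
  apply/esym; apply: (tail_form_eq (tail_VI b (c n))).
  by have := coeff_VI coeff; rewrite !cmpE.
rewrite -face0_cyc_op -cmpA cyc_op1_twice cmpm1; exact/esym/cmp1m.
Qed.

Lemma face_face_interior n i j : i < j <= n.+1 ->
  face_op n i ∘ face_op n.+1 j = face_op n j.-1 ∘ face_op n.+1 i.
Proof.
move=> ij; have [ij' j_le] := andP ij.
have le_in : i <= n by rewrite -ltnS (leq_trans ij').
rewrite !faceE //; last 2 first.
- by rewrite (leq_trans le_in).
- by case: (j) ij' j_le.
by rewrite -!fmor_cmp !tenlM counit_counit_at.
Qed.

(** The last face is [d_0 t], and the rotation can be carried across the other
    face by [face_cyc_op]; this reduces everything to the interior faces. *)
Lemma face_face_op n i j : i < j <= n.+2 ->
  face_op n i ∘ face_op n.+1 j = face_op n j.-1 ∘ face_op n.+1 i.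
Proof.
case/andP=> ij; rewrite leq_eqVlt => /orP[/eqP e|j_le]; last first.
  by rewrite face_face_interior // ij.
subst j; rewrite -[n.+2.-1]/n.+1 -!face0_cyc_op.
move: ij; rewrite ltnS leq_eqVlt => /orP[/eqP->|i_le].
  rewrite -!face0_cyc_op -!cmpA.
  rewrite (comp_eql (esym (@face_cyc_op n.+1 1 isT))) -(@face_cyc_op n.+1 n.+2) ?leqnn //.
  by rewrite -face0_cyc_op !cmpA face_face_interior.
rewrite -cmpA -(@face_cyc_op n.+1 i.+1) ?ltnS ?(ltnW i_le) // !cmpA.
by rewrite (@face_face_interior n 0 i.+1).
Qed.

Lemma degen_cyc_op n (n_gt0 : 0 < n.+1) i : 0 < i <= n.+1 ->
  degen_op n_gt0 i ∘ cyc_op n.+1 = cyc_op n.+2 ∘ degen_op n_gt0 i.-1.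
Proof.
case/andP=> i_gt0; rewrite leq_eqVlt => /orP[/eqP->|le_in].
  exact: degen_cyc_last.
by rewrite degen_cyc_interior // i_gt0.
Qed.

Lemma splitT_counit U :
  (C \oxl M \oxl counitT p (C \ox U)) ∘ splitT b (C \ox U) =
  splitT b U ∘ (M \oxl counitT p (C \ox U)).
Proof.
have K : (C \oxl braidT b U) ∘ (C \oxl braidT' b U) = idm _.
  by rewrite tenlM braidT'K ten1.
apply: (split_mono K); apply: (split_epi (braidT'K b (C \ox U))).
apply: (tail_form_eq (tail_III_splitT U)).
by have := coeff_III coeff; rewrite !cmpE.
Qed.

Lemma splitT_comul U :
  (C \oxl M \oxl comulT p U) ∘ splitT b U =
  splitT b (C \ox U) ∘ (M \oxl comulT p U).
Proof.
apply/esym; apply: (tail_form_eq (tail_II_splitT U)).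
by have := coeff_II coeff; rewrite !cmpE.
Qed.

Lemma face_degen_lt_op n (n_gt0 : 0 < n.+1) (n1_gt0 : 0 < n.+2) i j :
  i < j <= n.+2 ->
  face_op n.+2 i ∘ degen_op n1_gt0 j = degen_op n_gt0 j.-1 ∘ face_op n.+1 i.
Proof.
move=> ij; have [ij' j_le] := andP ij.
have le_in : i <= n.+1 by rewrite -ltnS (leq_trans ij').
move: j_le; rewrite leq_eqVlt => /orP[/eqP e|j_le].
  rewrite e face_degen_last_lhs // face_degen_last_rhs //.
  congr (_ ∘ T _); case: i le_in {ij ij'} => [|i] le_in.
    by rewrite !counit_at0 splitT_counit.
  by rewrite -splitT_natural.
have j1_le : j.-1 <= n by case: (j) ij' j_le.
rewrite !faceE ?(leq_trans le_in) // !degenE //.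
by rewrite -!fmor_cmp !tenlM counit_comul_at_lt // ij'.
Qed.

Lemma face_degen_id_op n (n_gt0 : 0 < n.+1) i : i <= n.+1 ->
  face_op n.+1 i ∘ degen_op n_gt0 i = idm _.
Proof.
rewrite leq_eqVlt => /orP[/eqP->|le_in]; first exact: face_degen_last.
rewrite faceE 1?ltnW // degenE // -fmor_cmp tenlM counit_comul_at_eq //.
by rewrite ten1 fmor1.
Qed.

Lemma face_degen_idS_op n (n_gt0 : 0 < n.+1) i : i <= n.+1 ->
  face_op n.+1 i.+1 ∘ degen_op n_gt0 i = idm _.
Proof.
rewrite leq_eqVlt => /orP[/eqP->|le_in].
  rewrite face_degen_lastS.
  rewrite -(tail_form_eq (tail_IV b (c n)) _).
    by rewrite -fmor_cmp braidT'K fmor1.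
  by have := coeff_IV coeff; rewrite !cmpE.
rewrite faceE // degenE // -fmor_cmp tenlM counit_comul_at_eqS //.
by rewrite ten1 fmor1.
Qed.

Lemma face_degen_gt_op n (n_gt0 : 0 < n.+1) (n1_gt0 : 0 < n.+2) i j :
  j.+1 < i <= n.+3 ->
  face_op n.+2 i ∘ degen_op n1_gt0 j = degen_op n_gt0 j ∘ face_op n.+1 i.-1.
Proof.
case/andP=> ij; rewrite leq_eqVlt => /orP[/eqP e|i_le].
  subst i; rewrite -[n.+3.-1]/n.+2 -!face0_cyc_op -cmpA.
  have := @degen_cyc_op n.+1 n1_gt0 j.+1 ij => /= <-.
  by rewrite cmpA (@face_degen_lt_op n n_gt0 n1_gt0 0 j.+1 ij) -cmpA.
have j_le : j <= n by rewrite -2!ltnS (leq_trans ij).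
have i1_le : i.-1 <= n.+1 by case: (i) ij i_le.
rewrite !faceE // !degenE ?(leqW j_le) //.
by rewrite -!fmor_cmp !tenlM counit_comul_at_gt // ij.
Qed.

Lemma degen_degen_op n (n_gt0 : 0 < n.+1) (n1_gt0 : 0 < n.+2) i j :
  i <= j <= n.+1 ->
  degen_op n1_gt0 i ∘ degen_op n_gt0 j = degen_op n1_gt0 j.+1 ∘ degen_op n_gt0 i.
Proof.
case/andP=> ij; rewrite leq_eqVlt => /orP[/eqP e|j_le].
  subst j; move: ij; rewrite leq_eqVlt => /orP[/eqP->|i_le].
    exact: degen_degen_last.
  rewrite degen_degen_last_lhs // degen_degen_last_rhs //.
  congr (_ ∘ T _); case: n i n_gt0 n1_gt0 i_le => [|n] [|i] // _ _ i_le.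
  - by rewrite !comul_at0 splitT_comul.
  - by rewrite !comul_at0 splitT_comul.
  by rewrite -splitT_natural.
have i_le : i <= n by apply: leq_trans ij _.
rewrite !degenE ?(leqW i_le) // -!fmor_cmp !tenlM comul_comul_at // ij.
by rewrite -ltnS.
Qed.

(** I gives all cases but the lowest one, where [t_2^3 = 1] and [t_1^2 = 1] turn
    the claim into [s_1 t_1 = t_2 s_0]. *)
Lemma degen0_cyc_op n (n_gt0 : 0 < n.+1) :
  degen_op n_gt0 0 ∘ cyc_op n.+1 =
  cyc_op n.+2 ∘ (cyc_op n.+2 ∘ degen_op n_gt0 n.+1).
Proof.
case: n n_gt0 => [|n] n_gt0.
  (* [t_2] is cancelled on the left, its inverse being [t_2^2]. *)
  apply: (split_mono (_ : (cyc_op 2 ∘ cyc_op 2) ∘ cyc_op 2 = idm _)).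
    by rewrite -cmpA cyc_op2_thrice.
  rewrite cmpA -(@degen_cyc_op 0 n_gt0 1) // -cmpA cyc_op1_twice cmpm1.
  by rewrite !cmpA -[(cyc_op 2 ∘ _) ∘ cyc_op 2]cmpA cyc_op2_thrice cmp1m.
rewrite degen0_cyc_lhs degen0_cyc_rhs; congr (T _ ∘ _).
have K : (C \oxl braidT b (c n)) ∘ (C \oxl braidT' b (c n)) = idm _.
  by rewrite tenlM braidT'K ten1.
rewrite -(tail_form_eq (tail_I b (c n)) _); last first.
  by have := coeff_I coeff; rewrite !cmpE.
by rewrite -!cmpA K cmpm1.
Qed.

Lemma cyclic_of_coefficients : cyclic (tr_ops Tr b).
Proof.
split; last first.
  move=> n; rewrite -[RHS]cyc_op_iter.
  by elim: (n.+1) => [//|m IH]; rewrite !iterS IH; apply: cmpE.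
split.
- by move=> n i j ij; rewrite !cmpE; apply: face_face_op.
- by case=> // n Dn Dn1 i j ij; rewrite !cmpE; apply: degen_degen_op.
- by case=> // n Dn Dn1 i j ij; rewrite !cmpE; apply: face_degen_lt_op.
- by case=> // n Dn i le_in; rewrite cmpE; apply: face_degen_id_op.
- by case=> // n Dn i le_in; rewrite cmpE; apply: face_degen_idS_op.
- by case=> // n Dn Dn1 i j ij; rewrite !cmpE; apply: face_degen_gt_op.
- by move=> n i le_in; rewrite !cmpE; apply: face_cyc_op.
- by move=> n; rewrite cmpE; apply: face0_cyc_op.
- by case=> // n Dn i le_in; rewrite !cmpE; apply: degen_cyc_op.
by case=> // n Dn; rewrite !cmpE; apply: degen0_cyc_op.
Qed.

End FromCoefficients.

Section ToCoefficients.
Hypotheses (faith : trace_faithful p Tr) (para : paracyclic (tr_ops Tr b)).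

(** The tail is [C] itself: faithfulness is available for [C^n] with [n > 0]. *)
Lemma faithful_tail (a a' d d' : X) (f g : hom a d) (f' g' : hom a' d') :
  tail_form (c 1) f g f' g' -> T f' = T g' -> f = g.
Proof.
move=> tf e; apply: (faith (ltn0Sn 0)); exact: tail_form_fmor tf e.
Qed.

Lemma axiom_VI_of_para : beta ∘ (C \oxl counitT p M) =
  (M \oxl counitT p C) ∘ braidT b C ∘ (C \oxl beta).
Proof.
apply: faithful_tail (tail_VI b (c 1)) _.
(* Two copies of [C] are flipped, so a tail [C] requires degree 3. *)
have e : face_op 2 3 ∘ cyc_op 3 = cyc_op 2 ∘ face_op 2 2.
  by rewrite -!cmpE; apply: (face_cyc para (i := 3)).
move: e; rewrite face_cyc_last_lhs face_cyc_last_rhs => e.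
have K : (phi 1 1 ∘ phi 0 2) ∘ (psi 0 2 ∘ psi 1 1) = idm _.
  by rewrite -!cmpA (comp_idl (front_to_lastK p Tr M 0 2)) front_to_lastK.
exact/esym/(split_epi K e).
Qed.

Lemma axiom_I_of_para :
  (M \oxl comulT p C) ∘ braidT b C ∘ (C \oxl beta) =
  braidT b (C \ox C) ∘ (C \oxl braidT b C) ∘ (C \oxl C \oxl beta) ∘
    (C \oxl comulT p M).
Proof.
apply: faithful_tail (tail_I b (c 1)) _.
have e : degen_op (ltn0Sn 2) 0 ∘ cyc_op 3 =
    cyc_op 4 ∘ (cyc_op 4 ∘ degen_op (ltn0Sn 2) 3).
  by rewrite -!cmpE; apply: (degen0_cyc para).
move: e; rewrite degen0_cyc_lhs degen0_cyc_rhs => /(split_epi (front_to_lastK p Tr M 0 2)) e.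
by rewrite fmor_cmp e -fmor_cmp -!cmpA tenlM braidTK ten1 cmpm1.
Qed.

Lemma axiom_II_of_para :
  (C \oxl braidT b C) ∘ comulT p (M \ox C) ∘ braidT' b C ∘ (M \oxl comul p) =
  (C \oxl M \oxl comul p) ∘ (C \oxl beta) ∘ comulT p M ∘ beta'.
Proof.
apply: faithful_tail (tail_II_splitT (c 1)) _.
have e : degen_op (ltn0Sn 2) 0 ∘ degen_op (ltn0Sn 1) 2 =
    degen_op (ltn0Sn 2) 3 ∘ degen_op (ltn0Sn 1) 0.
  by rewrite -!cmpE; apply: (degen_degen para (n := 2) _ _ (i := 0) (j := 2)).
move: e; rewrite degen_degen_last_lhs // degen_degen_last_rhs //.
by move/(split_mono (front_to_lastK p Tr M 0 3)).
Qed.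

Lemma axiom_III_of_para :
  (C \oxl beta') ∘ (C \oxl M \oxl counitT p C) ∘ (C \oxl braidT b C) ∘
      comulT p (M \ox C) =
  comulT p M ∘ beta' ∘ (M \oxl counitT p C) ∘ braidT b C.
Proof.
apply: faithful_tail (tail_III_splitT (c 1)) _.
have e : face_op 3 0 ∘ degen_op (ltn0Sn 2) 3 =
    degen_op (ltn0Sn 1) 2 ∘ face_op 2 0.
  by rewrite -!cmpE; apply: (face_degen_lt para (n := 2) _ _ (i := 0) (j := 3)).
move: e; rewrite face_degen_last_lhs // face_degen_last_rhs //.
move/(split_mono (front_to_lastK p Tr M 0 2)) => e.
by rewrite 2!fmor_cmp e -!fmor_cmp.
Qed.

Lemma axiom_IV_of_para :
  beta = (M \oxl counitT p C) ∘ braidT b C ∘ (C \oxl beta) ∘ comulT p M.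
Proof.
apply: faithful_tail (tail_IV b (c 1)) _.
have e : face_op 2 3 ∘ degen_op (ltn0Sn 1) 2 = idm _.
  by rewrite -!cmpE; apply: (face_degen_idS para (n := 2) _ (i := 2)).
move: e; rewrite face_degen_lastS => e.
have K : T (braidT' b (c 1)) ∘ T (braidT b (c 1)) = idm _.
  by rewrite -fmor_cmp braidTK fmor1.
by rewrite -[RHS]cmpm1 -K cmpA e cmp1m.
Qed.

Lemma coefficients_of_paracyclic : coefficients b.
Proof.
split; rewrite !cmpE.
- exact: axiom_I_of_para.
- exact: axiom_II_of_para.
- exact: axiom_III_of_para.
- exact: axiom_IV_of_para.
- exact: (axiom_V_of_VI axiom_VI_of_para).
- exact: axiom_VI_of_para.
Qed.

End ToCoefficients.
End Equivalence.

Theorem theorem4 (X S : ncscheme) (p : ncmorphism X S) (Tr : trace_functor X) :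
  (forall (M : X) (b : braiding p M),
     cyclic_system Tr b -> cyclic (tr_ops Tr b))
  /\
  (trace_faithful p Tr ->
     forall (M : X) (b : braiding p M),
       trace_compatible Tr b -> paracyclic (tr_ops Tr b) -> cyclic_system Tr b).
Proof.
split=> [M b [coeff compat]|faith M b compat para].
  exact: cyclic_of_coefficients.
by split; first exact: coefficients_of_paracyclic para.
Qed.
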